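(* Fix any $\mu>0$, $\nu>0$ and $0<\lambda<1$. Then there exists $N_0$ (depending on $\lambda,\mu,\nu$) such that for every $N\ge N_0$ the system with $N$ servers under the TABS scheme is stable, i.e. the Markov chain $(\mathbf Q^N(t),\Delta_0^N(t),\Delta_1^N(t))_{t\ge 0}$ is positive recurrent.
   Context: **TABS model.** There are $N$ identical servers and one dispatcher. Tasks arrive as a Poisson process of rate $\lambda N$; service requirements are i.i.d. exponential with mean $1$; every server has an infinite buffer and serves at unit rate whenever it is busy (with a discipline oblivious to the service requirements, e.g. FCFS). At each time every server is in exactly one of four states: busy (queue length $\ge 1$, counting the task in service), idle-on, idle-off, or in setup; the last three have queue length $0$. The dynamics are as follows (all exponential clocks are independent). - When a busy server's queue empties, it becomes idle-on. An idle-on server turns idle-off after an $\mathrm{Exp}(\mu)$ time (mean $1/\mu$), unless it is assigned a task before that. - When a task arrives and there is at least one idle-on server, the task is assigned to an idle-on server chosen uniformly at random, which becomes busy. - When a task arrives and there is no idle-on server, the task is assigned to a busy server chosen uniformly at random (and is lost if there is no busy server); in addition, if there is at least one idle-off server at that epoch, one of them, chosen uniformly at random, starts its setup procedure (moves to the setup state). - A setup takes an $\mathrm{Exp}(\nu)$ time (mean $1/\nu$), is never aborted, and at its end the server becomes idle-on. **Notation.** $Q_i^N(t)$, $i\ge 1$, is the number of servers with queue length at least $i$ at time $t$ (including a task in service), $\mathbf Q^N(t)=(Q_1^N(t),Q_2^N(t),\dots)$; $\Delta_0^N(t)$ and $\Delta_1^N(t)$ are the numbers of idle-off servers and of servers in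 setup at time $t$. The process $(\mathbf Q^N(t),\Delta_0^N(t),\Delta_1^N(t))$ is an irreducible countable-state continuous-time Markov chain; ''stable'' means positive recurrent. *)

(* Defs.v *)
From mathcomp Require Import all_boot all_order all_algebra.
From mathcomp Require Import all_classical all_reals all_analysis.
From mathcomp Require Import measurable_realfun.
Set Implicit Arguments.
Unset Strict Implicit.
Unset Printing Implicit Defensive.
Import Order.TTheory GRing.Theory Num.Theory.
Local Open Scope classical_set_scope.
Local Open Scope ring_scope.

Section MarkovJumpProcess.
Context {R : realType} {T : countType}.
(* [r x y] is the rate of jumping from [x] to [y]; diagonal values are
   ignored. *)
Variable r : T -> T -> R.

Definition exit_rate (x : T) : R :=
  fine (\esum_(y in [set y | y != x]) (r x y)%:E).

(* Transition probabilities of the embedded chain; a state that is never left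
   is absorbing. *)
Definition jump_prob (x y : T) : R :=
  if exit_rate x == 0 then (x == y)%:R
  else if x == y then 0 else r x y / exit_rate x.

Context {d : measure_display} {Omega : measurableType d}.
Variable P : probability Omega R.

(* [Y n] is the n-th visited state and [S n] the time spent there; [S n] is
   extended-valued because it is infinite in an absorbing state.  The last
   clause says that [Y] is a Markov chain with transition probabilities
   [jump_prob] started at [x] and that, given [Y], the [S n] are independent
   with [S n] exponential of parameter [exit_rate (Y n)]. *)
Record markov_jump_process (x : T) (Y : nat -> Omega -> T)
    (S : nat -> Omega -> \bar R) : Prop := MarkovJumpProcess {
  measurable_visited : forall n y, measurable (Y n @^-1` [set y]);
  measurable_holding : forall n, measurable_fun setT (S n);
  holding_gt0 : forall n w, (0 < S n w)%E;
  markov_jump_law : forall (n : nat) (y : nat -> T) (t : nat -> R),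
    (forall i, 0 <= t i) ->
    P [set w | forall i, (i <= n)%N -> Y i w = y i /\ ((t i)%:E < S i w)%E]
    = ((y 0%N == x)%:R
       * (\prod_(i < n) jump_prob (y i) (y i.+1))
       * (\prod_(i < n.+1) expR (- (exit_rate (y i) * t i))))%:E
}.

Definition jump_time (S : nat -> Omega -> \bar R) (n : nat) (w : Omega) :
  \bar R := (\sum_(i < n) S i w)%E.

(* The process in continuous time, X(t) = y.  It holds for no [y] if the
   process has exploded before time [t]. *)
Definition in_state_at (Y : nat -> Omega -> T) (S : nat -> Omega -> \bar R)
    (w : Omega) (t : R) (y : T) : Prop :=
  exists n, Y n w = y /\
    (jump_time S n w <= t%:E)%E /\ (t%:E < jump_time S n.+1 w)%E.

(* inf {t >= first jump time | X(t) = x}, equal to +oo if there is no such t *)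
Definition return_time (x : T) (Y : nat -> Omega -> T)
    (S : nat -> Omega -> \bar R) (w : Omega) : \bar R :=
  ereal_inf [set t%:E | t in
    [set t : R | (jump_time S 1 w <= t%:E)%E /\ in_state_at Y S w t x]].

End MarkovJumpProcess.

(* The law of [(Y, S)] is determined by [r] and [x], so the choice of
   realization is immaterial. *)
Definition positive_recurrent_state (R : realType) (T : countType)
    (r : T -> T -> R) (x : T) : Prop :=
  forall (d : measure_display) (Omega : measurableType d)
    (P : probability Omega R) (Y : nat -> Omega -> T)
    (S : nat -> Omega -> \bar R),
  markov_jump_process r P x Y S ->
  (\int[P]_w return_time x Y S w < +oo)%E.

Definition positive_recurrent (R : realType) (T : countType)
    (r : T -> T -> R) : Prop :=
  forall x : T, positive_recurrent_state r x.

(* A configuration [(q, d0, d1)]: [q] lists the nonzero terms of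
   Q_1 >= Q_2 >= ..., [d0] is the number of idle-off servers and [d1] the
   number of servers in setup. *)
Definition config := (seq nat * nat * nat)%type.

(* Q_i, for i >= 1 *)
Definition occ (q : seq nat) (i : nat) : nat := nth 0%N q i.-1.

Definition tabs_config (N : nat) (c : config) : bool :=
  let: (q, d0, d1) := c in
  [&& sorted geq q, 0%N \notin q & (occ q 1 + d0 + d1 <= N)%N].

Definition tabs_state (N : nat) := {c : config | tabs_config N c}.

(* A busy server with queue length [i] receives, resp. completes, a task:
   Q_{i+1} increases, resp. Q_i decreases, by one. *)
Definition occ_arrival (q : seq nat) (i : nat) : seq nat := incr_nth q i.

Definition occ_departure (q : seq nat) (i : nat) : seq nat :=
  [seq n <- set_nth 0%N q i.-1 (occ q i).-1 | (0 < n)%N].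

Section TABS.
Context {R : realType}.
Variables (lambda mu nu : R) (N : nat).

Definition idle_on (c : config) : nat :=
  let: (q, d0, d1) := c in (N - (occ q 1 + d0 + d1))%N.

(* Lists of pairs (rate, new configuration).  The number of servers with queue
   length exactly i is Q_i - Q_{i+1}. *)
Definition tabs_arrivals (c : config) : seq (R * config) :=
  let: (q, d0, d1) := c in
  if (0 < idle_on c)%N then
    [:: (lambda * N%:R, (occ_arrival q 0, d0, d1))]
  else
    let: (d0', d1') := if (0 < d0)%N then (d0.-1, d1.+1) else (d0, d1) in
    if occ q 1 == 0%N then [:: (lambda * N%:R, (q, d0', d1'))]
    else [seq (lambda * N%:R * ((occ q i - occ q i.+1)%N%:R / (occ q 1)%:R),
               (occ_arrival q i, d0', d1')) | i <- iota 1 (size q)].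

Definition tabs_departures (c : config) : seq (R * config) :=
  let: (q, d0, d1) := c in
  [seq ((occ q i - occ q i.+1)%N%:R, (occ_departure q i, d0, d1))
     | i <- iota 1 (size q)].

Definition tabs_switches (c : config) : seq (R * config) :=
  let: (q, d0, d1) := c in
  [:: (mu * (idle_on c)%:R, (q, d0.+1, d1));
      (nu * d1%:R, (q, d0, d1.-1))].

Definition tabs_transitions (c : config) : seq (R * config) :=
  tabs_arrivals c ++ tabs_departures c ++ tabs_switches c.

Definition tabs_rate (x y : tabs_state N) : R :=
  \sum_(e <- tabs_transitions (val x) | e.2 == val y) e.1.

End TABS.

(* Main.v *)
(* Let [M] be the number of tasks, [B] the number of busy servers, and take as
   Lyapunov function half the sum of the squared queue lengths plus [M * phi],
   where [phi] is a bounded function of the numbers of busy, idle-on, idle-off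
   and setup servers. Up to bounded terms its drift is [M] times
     lambda * N * 1(no idle-on server) / B - 1 + drift of phi.
   The drift of [phi] also depends on the number [w <= B] of servers with a
   single task, which is treated as an adversarial control.
   - When [B] is not much smaller than [lambda * N], a small linear cost of the
     idle-off and setup servers makes the bracket negative: it is paid back
     whenever an arrival finds no idle-on server.
   - When [B] is smaller, [ell], which is [B] plus small concave bonuses for
     idle-on and setup servers, drifts upwards at a rate proportional to [N]
     whatever [w] is. A large multiple of [exp (- c * ell)] then outweighs
     [lambda * N / B] and is exponentially small in [N] in the first case.
   So for [N] large the drift is negative outside a finite set; irreducibility
   and Foster's argument conclude. *)
Require Import Defs.
From mathcomp Require Import all_boot all_order all_algebra.
From mathcomp Require Import all_classical all_reals all_analysis.
From mathcomp Require Import measurable_realfun ring lra zify.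
Set Implicit Arguments.
Unset Strict Implicit.
Unset Printing Implicit Defensive.
Import Order.TTheory GRing.Theory Num.Theory.
Local Open Scope ring_scope.

(** * Foster's criterion for jump processes *)

Section Foster.
Local Open Scope classical_set_scope.
Local Open Scope ring_scope.

(** The delicate point is the upward drift of [ell] when no server is idle-on: arrivals then leave
    the number of busy servers unchanged while departures lower it. An idle-on server must therefore
    be worth almost as much as a busy one, so that a departure is nearly neutral, but slightly less,
    so that giving it a task is still progress. The deficit [sg] in its value costs up to order
    [sg * N]. It is covered by setup bonuses of the same order: either many setups are in progress
    and their completions pay, or some server is idle-off and each arrival starts a setup. Two
    thresholds [l1 < l0 < lambda] are used. The exponential must be huge for [B <= l1 * N] and
    negligible for [B > l0 * N]; in the zone between them its mean decrease alone suffices. All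
    constants but the amplitude of the exponential are fixed before [N] or scale linearly with it.
    In Foster's argument no finiteness is invoked: a function [h] bounds the number of jumps needed
    to reach a given state, up to a constant, and states with bounded [h] take the place of the
    finite set. *)

Lemma nneseries_le (R : realType) (u : nat -> \bar R) (B : \bar R) :
  (forall n, 0 <= u n)%E -> (forall n, \sum_(i < n) u i <= B)%E ->
  (\sum_(n <oo) u n <= B)%E.
Proof.
move=> u0 uB; apply: lime_le; first by apply: is_cvg_nneseries.
by apply: nearW => n; rewrite big_mkord; exact: uB.
Qed.

Lemma ge_nneseries (R : realType) (u : nat -> \bar R) n :
  (forall n, 0 <= u n)%E -> (\sum_(i < n) u i <= \sum_(n <oo) u n)%E.
Proof.
move=> u0; rewrite -(big_mkord xpredT u); exact: nneseries_lim_ge.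
Qed.

(** The integral of a nonnegative function is a supremum over the simple functions below it, hence
    monotone for measurable and nonmeasurable functions alike. It is applied to [return_time], an
    infimum over uncountably many times. *)
Lemma ge0_le_integral_nonmeas d (T : measurableType d) (R : realType)
    (mu : {measure set T -> \bar R}) (f g : T -> \bar R) :
  (forall x, 0 <= f x)%E -> (forall x, f x <= g x)%E ->
  (\int[mu]_x f x <= \int[mu]_x g x)%E.
Proof.
move=> f0 fg; have g0 x : (0 <= g x)%E by exact: le_trans (fg x).
rewrite !ge0_integralTE//; apply: le_ereal_sup => _ [h hf <-].
by exists h => // x; exact: le_trans (fg x).
Qed.

Context {R : realType} {T : countType}.
Variables (r : T -> T -> R) (succ : T -> seq T).
Hypothesis r_ge0 : forall y z, 0 <= r y z.
Hypothesis succ_uniq : forall y, uniq (succ y).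
Hypothesis r_succ : forall y z, z \notin succ y -> r y z = 0.

Lemma exit_rateE y : exit_rate r y = \sum_(z <- succ y | z != y) r y z.
Proof.
rewrite /exit_rate -(big_filter _ (fun z => z != y)).
set s := [seq z <- succ y | z != y].
have -> : \esum_(z in [set z | z != y]) (r y z)%:E
        = \esum_(z in [set` s]) (r y z)%:E.
  rewrite esum_mkcond [RHS]esum_mkcond; apply: eq_esum => z _.
  have -> : (z \in [set z | z != y]) = (z != y) by exact: asboolb.
  have -> : (z \in [set` s]) = (z \in s) by exact: asboolb.
  rewrite /s mem_filter; case: eqP => //= _; case: ifPn => // zs.
  by rewrite r_succ.
rewrite esum_fset//; first by rewrite -fsbig_seq ?filter_uniq//= sumEFin.
  exact: finite_seq.
by move=> z _; rewrite lee_fin.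
Qed.

Lemma measure_le_sum_seq d (Om : measurableType d) (mu : {measure set Om -> \bar R})
    (s : seq T) (A : T -> set Om) (B : set Om) :
  measurable B -> (forall z, measurable (A z)) ->
  (forall w, B w -> exists2 z, z \in s & A z w) ->
  (mu B <= \sum_(z <- s) mu (A z))%E.
Proof.
move=> mB mA; elim: s B mB => [|z s IH] B mB sub.
  by rewrite big_nil (_ : B = set0) ?measure0// -subset0 => w /sub[].
rewrite big_cons; have mBD : measurable (B `\` A z) by exact: measurableD.
have /IH h : forall w, (B `\` A z) w -> exists2 z, z \in s & A z w.
  move=> w [/sub[z']]; rewrite inE => /predU1P[-> //|zs Aw _]; by exists z'.
apply: (@le_trans _ _ (mu (A z `|` (B `\` A z)))).
  apply: le_measure; rewrite ?inE//; first exact: measurableU.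
  by move=> w Bw; have [?|?] := pselect (A z w); [left|right].
by apply: (le_trans (measureU2 _ _ _)) => //; exact/leeD2l/h.
Qed.

Variables (x : T) (V : T -> R) (qmin qmax : R).
Hypothesis qmin_gt0 : 0 < qmin.
Hypothesis exit_ge : forall y, qmin <= exit_rate r y.
Hypothesis exit_le : forall y, exit_rate r y <= qmax.
Hypothesis V_ge0 : forall y, 0 <= V y.
Hypothesis V_drift : forall y, y != x ->
  \sum_(z <- succ y) r y z * (V z - V y) <= - 1.

Lemma exit_rate_gt0 y : 0 < exit_rate r y.
Proof. exact: lt_le_trans (exit_ge y). Qed.

Lemma jump_probE y z :
  jump_prob r y z = if y == z then 0 else r y z / exit_rate r y.
Proof. by rewrite /jump_prob gt_eqF ?exit_rate_gt0. Qed.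

Lemma jump_prob_ge0 y z : 0 <= jump_prob r y z.
Proof.
by rewrite jump_probE; case: ifP => // _; rewrite divr_ge0// ltW// exit_rate_gt0.
Qed.

(** Dividing by the exit rate turns a drift per unit of time into a mean decrease per jump, and
    jumps occur at rate at most [qmax]. *)
Lemma jump_prob_drift y : y != x ->
  \sum_(z <- succ y) jump_prob r y z * V z <= V y - qmax^-1.
Proof.
move=> yx; have E0 := exit_rate_gt0 y.
have drift := V_drift yx.
rewrite (bigID (fun z => z != y))/= [X in _ + X]big1 in drift; last first.
  by move=> z /negPn/eqP->; rewrite subrr mulr0.
rewrite addr0 (eq_bigr (fun z => r y z * V z - r y z * V y)) in drift; last first.
  by move=> z _; rewrite mulrBr.
rewrite sumrB -mulr_suml -exit_rateE in drift.
rewrite (bigID (fun z => z != y))/= [X in _ + X]big1 => [|z /negPn/eqP->]; last first.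
  by rewrite jump_probE eqxx mul0r.
rewrite addr0 (eq_bigr (fun z => r y z * V z / exit_rate r y)); last first.
  by move=> z zy; rewrite jump_probE eq_sym (negPf zy) mulrAC.
rewrite -mulr_suml ler_pdivrMr// mulrBl.
apply: (@le_trans _ _ (V y * exit_rate r y - 1)); first by rewrite mulrC; lra.
by rewrite lerD2l lerN2 mulrC ler_pdivrMr ?mul1r// (lt_le_trans E0).
Qed.

Lemma jump_prob_succ y z : z \notin succ y -> jump_prob r y z = 0.
Proof. by move=> zs; rewrite jump_probE r_succ// mul0r if_same. Qed.

(* [avoid n y] is the probability that the embedded chain started at [y] does
   not visit [x] at the times [1], ..., [n]. *)
Fixpoint avoid (n : nat) (y : T) : R :=
  if n is n'.+1 then \sum_(z <- succ y | z != x) jump_prob r y z * avoid n' z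
  else 1.

Lemma avoid_ge0 n y : 0 <= avoid n y.
Proof.
elim: n y => //= n IH y; apply: sumr_ge0 => z _.
by rewrite mulr_ge0 ?jump_prob_ge0.
Qed.

Lemma qmax_gt0 : 0 < qmax.
Proof. exact: lt_le_trans (exit_rate_gt0 x) (exit_le x). Qed.

Lemma sum_avoidS n y : \sum_(i < n.+1) avoid i y =
  1 + \sum_(z <- succ y | z != x) jump_prob r y z * \sum_(i < n) avoid i z.
Proof.
rewrite big_ord_recl /=; congr (_ + _); rewrite exchange_big /=.
by apply: eq_bigr => z _; rewrite mulr_sumr.
Qed.

Lemma sum_jump_prob_le n y :
  (forall z, z != x -> \sum_(i < n) avoid i z <= qmax * V z) ->
  \sum_(z <- succ y | z != x) jump_prob r y z * \sum_(i < n) avoid i z <=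
  qmax * \sum_(z <- succ y) jump_prob r y z * V z.
Proof.
move=> h; rewrite mulr_sumr [leRHS](bigID (fun z => z != x))/=.
rewrite -[leLHS]addr0 lerD//.
  by apply: ler_sum => z zx; rewrite mulrCA ler_wpM2l ?jump_prob_ge0 ?h.
by apply: sumr_ge0 => z _; rewrite !mulr_ge0 ?jump_prob_ge0// ltW// qmax_gt0.
Qed.

(** The sum is the expected number of jumps until [x] is hit, truncated at [n]; the mean decrease of
    [V] pays for each jump. The truncation allows an induction that does not presuppose that [x] is
    hit. *)
Lemma sum_avoid_le n y : y != x -> \sum_(i < n) avoid i y <= qmax * V y.
Proof.
elim: n y => [|n IH] y yx; first by rewrite big_ord0 mulr_ge0 ?(ltW qmax_gt0).
rewrite sum_avoidS; apply: (le_trans (lerD (lexx _) (sum_jump_prob_le y IH))).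
have := ler_wpM2l (ltW qmax_gt0) (jump_prob_drift yx).
by rewrite mulrBr divff ?gt_eqF ?qmax_gt0//; lra.
Qed.

Lemma sum_avoid_bounded : exists B, forall n, \sum_(i < n) avoid i x <= B.
Proof.
exists (1 + qmax * \sum_(z <- succ x) jump_prob r x z * V z); case=> [|n].
  rewrite big_ord0 addr_ge0// mulr_ge0 ?(ltW qmax_gt0)// sumr_ge0// => z _.
  by rewrite mulr_ge0 ?jump_prob_ge0.
by rewrite sum_avoidS lerD2l; apply: sum_jump_prob_le => z; exact: sum_avoid_le.
Qed.

(** * From the embedded chain to the expected return time *)

Section Realization.
Context {d : measure_display} {Omega : measurableType d}.
Variable P : probability Omega R.
Variables (Y : nat -> Omega -> T) (S : nat -> Omega -> \bar R).
Hypothesis YS : markov_jump_process r P x Y S.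

Lemma measurable_visitedC n (y : T) : measurable [set w | Y n w <> y].
Proof. by apply: measurableC; exact: (measurable_visited YS). Qed.

Lemma measurable_forall (Q : nat -> Prop) (C : nat -> set Omega) :
  (forall i, measurable (C i)) -> measurable [set w | forall i, Q i -> C i w].
Proof.
move=> mC; rewrite (_ : mkset _ = \bigcap_(i in [set i | Q i]) C i)//.
exact: bigcap_measurableType.
Qed.

Lemma measurable_holding_gt n t : measurable [set w | (t < S n w)%E].
Proof.
rewrite -[X in measurable X]setTI; apply: emeasurable_fun_o_infty => //.
exact: measurable_holding YS n.
Qed.

Definition path_prob n (y : nat -> T) : R :=
  (y 0%N == x)%:R * \prod_(i < n) jump_prob r (y i) (y i.+1).

Lemma path_prob_ge0 n y : 0 <= path_prob n y.
Proof. by rewrite mulr_ge0// prodr_ge0// => i _; exact: jump_prob_ge0. Qed.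

(** The joint law with lower bound 0 on every holding time but the last: as holding times are
    positive, these bounds are no constraint. *)
Lemma prob_path_holding n y t : 0 <= t ->
  P [set w | (forall i, (i <= n)%N -> Y i w = y i) /\ (t%:E < S n w)%E] =
  (path_prob n y * expR (- (exit_rate r (y n) * t)))%:E.
Proof.
move=> t0; pose s i : R := if i == n then t else 0.
have s0 i : 0 <= s i by rewrite /s; case: ifP.
have := markov_jump_law YS n y s0.
rewrite big_ord_recr/= [X in _ * (X * _)]big1 => [|i _]; last first.
  by rewrite /s ltn_eqF// mulr0 oppr0 expR0.
rewrite mul1r {2}/s eqxx => <-; congr (P _); apply/seteqP; split => w /=.
  move=> [Yw Sw] i ile; split; first exact: Yw.
  by rewrite /s; case: eqP => [->//|_]; exact: (holding_gt0 YS).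
move=> h; split => [i /h[]//|].
by have [] := h n (leqnn n); rewrite /s eqxx.
Qed.

Definition escape n m (y : nat -> T) (t : R) : set Omega :=
  [set w | (forall i, (i <= n)%N -> Y i w = y i) /\
    (forall i, (n < i <= n + m)%N -> Y i w <> x) /\ (t%:E < S (n + m) w)%E].

Lemma measurable_escape n m y t : measurable (escape n m y t).
Proof.
apply: measurableI; last apply: measurableI.
- by apply: measurable_forall => i; exact: (measurable_visited YS).
- by apply: measurable_forall => i; exact: measurable_visitedC.
- exact: measurable_holding_gt.
Qed.

Definition extend n (y : nat -> T) z i := if i == n then z else y i.

Lemma path_prob_extend n y z :
  path_prob n.+1 (extend n.+1 y z) = path_prob n y * jump_prob r (y n) z.
Proof.
have old i : (i <= n)%N -> extend n.+1 y z i = y i.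
  by move=> ile; rewrite /extend ltn_eqF.
have new : extend n.+1 y z n.+1 = z by rewrite /extend eqxx.
rewrite /path_prob big_ord_recr /= mulrA new !old//; congr (_ * _ * _).
by apply: eq_bigr => i _; rewrite !old// ltnW.
Qed.

(** Induction on the number [m] of steps avoiding [x], splitting according to the next state, which
    lies in the finite list [succ (y n)] outside a null event. *)
Lemma prob_escape_le m n y t : 0 <= t ->
  (P (escape n m y t) <=
   (path_prob n y * avoid m (y n) * expR (- (qmin * t)))%:E)%E.
Proof.
move=> t0; elim: m n y => [|m IH] n y.
  apply: (@le_trans _ _ (path_prob n y * expR (- (exit_rate r (y n) * t)))%:E).
    rewrite -prob_path_holding//; apply: le_measure; rewrite ?inE.
    - exact: measurable_escape.
    - apply: measurableI; last exact: measurable_holding_gt.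
      by apply: measurable_forall => i; exact: (measurable_visited YS).
    - by move=> w [Yw [_]]; rewrite addn0.
  rewrite lee_fin /= mulr1 ler_wpM2l ?path_prob_ge0// ler_expR lerN2.
  by rewrite ler_wpM2r.
pose A z := escape n.+1 m (extend n.+1 y z) t.
(* A move to [z] although its jump probability is 0. The vacuous bound on [S n.+1] gives the event
   the form treated by [prob_path_holding]; the countable union of these events is removed. *)
pose nul z : set Omega := if jump_prob r (y n) z == 0 then
  [set w | (forall i, (i <= n.+1)%N -> Y i w = extend n.+1 y z i) /\
           (0%:E < S n.+1 w)%E] else set0.
have mnul z : measurable (nul z).
  rewrite /nul; case: ifP => // _; apply: measurableI.
    by apply: measurable_forall => i; exact: (measurable_visited YS).
  exact: measurable_holding_gt.
have nul0 z : P (nul z) = 0%E.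
  rewrite /nul; case: ifP => [/eqP j0|_]; last by rewrite measure0.
  by rewrite prob_path_holding// path_prob_extend j0 mulr0 mul0r.
pose N := \bigcup_k (if unpickle k is Some z then nul z else set0).
have mN : measurable N.
  by apply: bigcupT_measurable => k; case: unpickle.
have PN : P N = 0%E.
  apply/negligibleP => //; apply: negligible_bigcup => k.
  case: unpickle => [z|]; last exact: negligible_set0.
  by exists (nul z); split=> //; exact: nul0.
have sub w : (escape n m.+1 y t `\` N) w ->
    exists2 z, z \in [seq z <- succ (y n) | z != x] & A z w.
  move=> [[Yw [Yx Sw]] Nw]; pose z := Y n.+1 w.
  have Yz i : (i <= n.+1)%N -> Y i w = extend n.+1 y z i.
    by rewrite /extend leq_eqVlt ltnS => /predU1P[->|ile];
      [rewrite eqxx|rewrite ltn_eqF ?ltnS// Yw].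
  exists z; last first.
    split=> //; rewrite addSnnS; split=> // i /andP[ni im].
    by apply: Yx; rewrite im (ltnW ni).
  rewrite mem_filter; apply/andP; split.
    by apply/eqP/Yx; rewrite ltnSn/= addnS ltnS leq_addr.
  apply: contra_notT Nw => zs; exists (pickle z) => //; rewrite pickleK.
  rewrite /nul jump_prob_succ// eqxx; split => //.
  exact: (holding_gt0 YS).
have mE := measurable_escape n m.+1 y t.
have mA z : measurable (A z) by exact: measurable_escape.
apply: (@le_trans _ _ (P ((escape n m.+1 y t `\` N) `|` N))).
  apply: le_measure; rewrite ?inE//.
    by apply: measurableU => //; exact: measurableD.
  by move=> w; have [|] := pselect (N w); [right|left].
have mEN : measurable (escape n m.+1 y t `\` N) by exact: measurableD.
apply: (le_trans (measureU2 _ mEN mN)); rewrite [X in (_ + X)%E]PN adde0.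
apply: (le_trans (measure_le_sum_seq _ mEN mA sub)).
rewrite big_filter /= mulr_sumr mulr_suml -sumEFin.
apply: lee_sum => z _; apply: (le_trans (IH _ _)).
by rewrite path_prob_extend /extend eqxx !mulrA.
Qed.

Lemma prob_start : P [set w | Y 0%N w = x] = 1%E.
Proof.
have := prob_path_holding 0 (fun=> x) (lexx 0).
rewrite mulr0 oppr0 expR0 mulr1 /path_prob eqxx big_ord0 mulr1 => <-.
congr (P _); apply/seteqP; split=> w /=; last by case=> Yw _; exact: Yw.
move=> Yw; split; last exact: (holding_gt0 YS).
by move=> i; rewrite leqn0 => /eqP->.
Qed.

Definition unreturned m (t : R) : set Omega :=
  [set w | (forall i, (0 < i <= m)%N -> Y i w <> x) /\ (t%:E < S m w)%E].

Lemma measurable_unreturned m t : measurable (unreturned m t).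
Proof.
apply: measurableI; last exact: measurable_holding_gt.
by apply: measurable_forall => i; exact: measurable_visitedC.
Qed.

Lemma prob_unreturned_le m t : 0 <= t ->
  (P (unreturned m t) <= (avoid m x * expR (- (qmin * t)))%:E)%E.
Proof.
move=> t0; have mU := measurable_unreturned m t.
have mE := measurable_escape 0 m (fun=> x) t.
have mN : measurable [set w | Y 0%N w <> x] by exact: measurable_visitedC.
have PN : P [set w | Y 0%N w <> x] = 0%E.
  have := probability_setC P (measurable_visited YS 0 x).
  by rewrite [X in (_ - X)%E]prob_start subee.
apply: (@le_trans _ _ (P (escape 0 m (fun=> x) t `|` [set w | Y 0%N w <> x]))).
  apply: le_measure; rewrite ?inE//; first exact: measurableU.
  move=> w [Yx Sw]; have [Y0|?] := pselect (Y 0%N w = x); last by right.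
  left; split; first by case.
  by split.
apply: (le_trans (measureU2 _ mE mN)); rewrite [X in (_ + X)%E]PN adde0.
apply: (le_trans (prob_escape_le _ _ _ t0)).
by rewrite /path_prob eqxx big_ord0 !mul1r.
Qed.

(** This is [S m] rounded up to an integer as long as no jump up to the [m]-th has returned to [x],
    and 0 otherwise. Its expectation is a sum of tail probabilities. *)
Definition unreturned_count m w : \bar R :=
  (\sum_(k <oo) (\1_(unreturned m k%:R) w)%:E)%E.

Lemma unreturned_count_ge0 m w : (0 <= unreturned_count m w)%E.
Proof. by apply: nneseries_ge0 => k _ _; rewrite lee_fin. Qed.

Lemma unreturned_count_ge m w n : (forall i, (0 < i <= m)%N -> Y i w <> x) ->
  (forall k, (k < n)%N -> (k%:R%:E < S m w)%E) -> (n%:R%:E <= unreturned_count m w)%E.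
Proof.
move=> Yx Sw; apply: (le_trans _ (ge_nneseries n _)) => [|k]; last by rewrite lee_fin.
rewrite sumEFin lee_fin -[n in n%:R]card_ord -sumr_const ler_sum// => i _.
by rewrite indicE mem_set//; split=> //; exact: Sw.
Qed.

Lemma unreturned_count_gt0 m w : (forall i, (0 < i <= m)%N -> Y i w <> x) ->
  (1 <= unreturned_count m w)%E.
Proof.
move=> Yx; apply: (@unreturned_count_ge m w 1 Yx) => k; rewrite ltnS leqn0 => /eqP->.
exact: (holding_gt0 YS).
Qed.

Lemma eq_pinfty_nat (a : \bar R) : (forall n, n%:R%:E <= a)%E -> a = +oo%E.
Proof.
move=> h; apply/eqyP => A A0; apply: (le_trans _ (h (Num.bound A))).
by rewrite lee_fin ltW// archi_boundP// ltW.
Qed.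

Lemma holding_le_unreturned_count m w :
  (forall i, (0 < i <= m)%N -> Y i w <> x) -> (S m w <= unreturned_count m w)%E.
Proof.
move=> Yx; have count n := @unreturned_count_ge m w n Yx.
case E : (S m w) => [s| |]; last by rewrite leNye.
- have ex : exists n, s <= n%:R by exists (Num.bound s); rewrite ltW// unstable.ltr_bound.
  case: (ex_minnP ex) => n sn nmin; apply: (@le_trans _ _ n%:R%:E) => //.
  apply: count => k; apply: contraTT; rewrite E lte_fin -leNgt -leqNgt; exact: nmin.
- rewrite (@eq_pinfty_nat (unreturned_count m w))// => n.
  by apply: count => k _; rewrite E ltry.
Qed.

Lemma return_time_le n w : (0 < n)%N -> Y n w = x ->
  (return_time x Y S w <= jump_time S n w)%E.
Proof.
move=> n0 Yn; have S0 i : (0 < S i w)%E by exact: (holding_gt0 YS).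
have J0 : (0 <= jump_time S n w)%E by apply: sume_ge0 => i _; exact: ltW.
have J1 : (jump_time S 1 w <= jump_time S n w)%E.
  case: n n0 {Yn J0} => // n _; rewrite /jump_time big_ord1 big_ord_recl leeDl//.
  by apply: sume_ge0 => i _; exact: ltW.
case E : (jump_time S n w) => [t| |]; [|by rewrite leey|by rewrite E in J0].
rewrite E in J1; apply: ereal_inf_lbound; exists t => //; split=> //.
exists n; rewrite E lexx; split=> //; split=> //.
have -> : jump_time S n.+1 w = (t%:E + S n w)%E by rewrite -E /jump_time big_ord_recr.
by rewrite lteDl.
Qed.

(** If the chain returns, the holding times before the first return are bounded by their counts. If
    it never does, every count is at least 1 and the right side is infinite. Recurrence and absence
    of explosion thus follow from the finiteness of one expectation. *)
Lemma return_time_le_count w :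
  (return_time x Y S w <= \sum_(m <oo) unreturned_count m w)%E.
Proof.
have count0 m : (0 <= unreturned_count m w)%E by exact: unreturned_count_ge0.
have [ex|nex] := pselect (exists n, (0 < n)%N && (Y n w == x)).
  case: (ex_minnP ex) => n /andP[n0 /eqP Yn] nmin.
  apply: (le_trans (return_time_le n0 Yn)).
  apply: (le_trans _ (ge_nneseries n _)) => //.
  apply: lee_sum => i _; apply: holding_le_unreturned_count => k /andP[k0 ki].
  move=> Yk; have := nmin k.
  by rewrite k0 Yk eqxx leqNgt (leq_ltn_trans ki)// => /(_ isT).
rewrite [leRHS]eq_pinfty_nat ?leey// => n.
apply: (le_trans _ (ge_nneseries n _)) => //.
apply: (@le_trans _ _ (\sum_(i < n) 1%E)%E).
  by rewrite sumEFin sumr_const card_ord.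
apply: lee_sum => i _; apply: unreturned_count_gt0 => k /andP[k0 _] Yk.
by apply: nex; exists k; rewrite k0 Yk eqxx.
Qed.

Lemma integral_return_time_fin : (\int[P]_w return_time x Y S w < +oo)%E.
Proof.
have [B avoidB] := sum_avoid_bounded.
pose z := expR (- qmin); have z0 : 0 < z by exact: expR_gt0.
have z1 : z < 1 by rewrite /z expR_lt1 oppr_lt0.
(* [B] bounds the expected number of jumps before the return, and [1 / (1 - z)] is the geometric sum
   of the tail bounds of one holding time at integer times. *)
apply: (@le_lt_trans _ _ (B / (1 - z))%:E); last by rewrite ltry.
have rt0 w : (0 <= return_time x Y S w)%E.
  apply: le_ereal_inf_tmp => _ [t [J1 _] <-]; apply: le_trans J1.
  by apply: sume_ge0 => i _; exact/ltW/(holding_gt0 YS).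
apply: (le_trans (ge0_le_integral_nonmeas _ rt0 return_time_le_count)).
have mc m : measurable_fun setT (unreturned_count m).
  apply: ge0_emeasurable_sum => [k w _ _|k _]; first by rewrite lee_fin.
  by apply/measurable_EFinP; exact/measurable_indicP/measurable_unreturned.
rewrite integral_nneseries//; last by move=> m w _; exact: unreturned_count_ge0.
apply: nneseries_le => [m|n].
  by apply: integral_ge0 => w _; exact: unreturned_count_ge0.
apply: (@le_trans _ _ (\sum_(m < n) (avoid m x / (1 - z))%:E)%E).
  apply: lee_sum => m _; rewrite integral_nneseries//; last first.
    by move=> k; apply/measurable_EFinP; exact/measurable_indicP/measurable_unreturned.
  apply: nneseries_le => [k|j]; first by apply: integral_ge0 => w _; rewrite lee_fin.
  apply: (@le_trans _ _ (\sum_(k < j) (avoid m x * z ^+ k)%:E)%E).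
    apply: lee_sum => k _; rewrite integral_indic ?setIT//; last first.
      exact: measurable_unreturned.
    by apply: (le_trans (prob_unreturned_le _ _)) => //; rewrite -expRM_natr mulNr.
  rewrite sumEFin lee_fin -mulr_sumr ler_wpM2l ?avoid_ge0//.
  have nz1 : `|z| < 1 by rewrite ger0_norm// ltW.
  rewrite -[leRHS]mul1r; apply: le_trans (geometric_le_lim j ler01 z0 nz1).
  rewrite /series /= big_mkord; apply: ler_sum => k _.
  by rewrite mul1r.
by rewrite sumEFin lee_fin -mulr_suml ler_wpM2r// invr_ge0 subr_ge0 ltW.
Qed.

End Realization.

Lemma foster_recurrent_state : positive_recurrent_state r x.
Proof. by move=> d Om P Y S; exact: integral_return_time_fin. Qed.

End Foster.

(** * Foster's criterion for irreducible chains *)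

Section FosterIrreducible.
Context {R : realType} {T : countType}.
Variables (r : T -> T -> R) (succ : T -> seq T).
Hypothesis r_ge0 : forall y z, 0 <= r y z.
Hypothesis succ_uniq : forall y, uniq (succ y).
Hypothesis r_succ : forall y z, z \notin succ y -> r y z = 0.
Variables (rmin Rmax : R).
Hypothesis rmin_gt0 : 0 < rmin.
Hypothesis rate_le : forall y, \sum_(z <- succ y) r y z <= Rmax.

Fixpoint reach (k : nat) (y x : T) : Prop :=
  if k is k'.+1 then exists z, rmin <= r y z /\ reach k' z x else y = x.

(** [h] links the two hypotheses: the drift of [V] is very negative where [h] is large, and where
    [h] is bounded every target can be reached in a bounded number of jumps. *)
Variables (V : T -> R) (h : T -> nat) (eps C : R).
Hypothesis V_ge0 : forall y, 0 <= V y.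
Hypothesis eps_gt0 : 0 < eps.
Hypothesis V_drift : forall y,
  \sum_(z <- succ y) r y z * (V z - V y) <= C - eps * (h y)%:R.
Hypothesis reach_in : forall x, exists c, forall y,
  exists k, (k <= h y + c)%N /\ reach k y x.
Hypothesis nontrivial : forall x : T, exists y, y != x.

Section Target.
Variable x : T.

Lemma reach_ex y : exists k, `[< reach k y x >].
Proof. by have [c /(_ y)[k [_ yx]]] := reach_in x; exists k; exact/asboolP. Qed.

Definition dist y := ex_minn (reach_ex y).

Lemma dist_le k y : reach k y x -> (dist y <= k)%N.
Proof. by rewrite /dist; case: ex_minnP => n _ nmin /asboolP/nmin. Qed.

Lemma dist_step y : y != x ->
  exists z, [/\ rmin <= r y z, (dist z < dist y)%N & z != y].
Proof.
rewrite /dist; case: ex_minnP => -[|n] /asboolP /=; first by move=> -> _ /eqP.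
move=> [z [yz zx]] nmin _; exists z; rewrite -/(dist z).
have zn : (dist z <= n)%N by exact: dist_le.
split=> //; apply: contraTneq zn => ->; rewrite -ltnNge.
by rewrite /dist; case: ex_minnP => m + _; exact: nmin.
Qed.

Lemma rate_succ y z : rmin <= r y z -> z \in succ y.
Proof.
apply: contraTT => /r_succ ->; by rewrite -ltNge.
Qed.

Lemma rate_ge y z : z \in succ y -> r y z <= \sum_(z <- succ y) r y z.
Proof.
by move=> zs; rewrite (bigD1_seq z)//= lerDl sumr_ge0.
Qed.

Lemma rmin_le : rmin <= Rmax.
Proof.
have [y yx] := nontrivial x; have [z [yz _ _]] := dist_step yx.
exact: le_trans yz (le_trans (rate_ge (rate_succ yz)) (rate_le y)).
Qed.

(** With this ratio a single jump of rate [rmin] towards [x] gains twice what all other jumps can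
    lose: [Rmax * theta ^+ n.+1] is half of [rmin * theta ^+ n]. *)
Definition theta : R := rmin / (2 * Rmax).

Lemma Rmax_gt0 : 0 < Rmax. Proof. exact: lt_le_trans rmin_le. Qed.

Lemma theta_gt0 : 0 < theta.
Proof. by rewrite divr_gt0// mulr_gt0// Rmax_gt0. Qed.

Lemma theta_le1 : theta <= 1.
Proof.
rewrite ler_pdivrMr ?mul1r ?mulr_gt0 ?Rmax_gt0//.
by have := rmin_le; have := Rmax_gt0; lra.
Qed.

Lemma theta_drift y : y != x ->
  theta ^+ (dist y).-1 * (rmin / 2) <=
  \sum_(z <- succ y) r y z * (theta ^+ dist z - theta ^+ dist y).
Proof.
move=> yx; have [z [yz zd zy]] := dist_step yx.
have t0 := theta_gt0; have zs := rate_succ yz.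
under eq_bigr do rewrite mulrBr.
rewrite sumrB -mulr_suml.
case E : (dist y) zd => [//|n] zn /=.
have -> : theta ^+ n * (rmin / 2) = rmin * theta ^+ n - Rmax * theta ^+ n.+1.
  by rewrite exprS /theta; field; rewrite gt_eqF// Rmax_gt0.
apply: lerB; last by rewrite ler_wpM2r// exprn_ge0// ltW.
rewrite (bigD1_seq z)//=; apply: (@le_trans _ _ (r y z * theta ^+ dist z)).
  apply: ler_pM => //; [exact: ltW|by rewrite exprn_ge0// ltW|].
  by rewrite ler_wiXn2l ?theta_le1// ltW.
by rewrite lerDl sumr_ge0// => i _; rewrite mulr_ge0// exprn_ge0// ltW.
Qed.

End Target.

Lemma rmin_le_exit_rate y : rmin <= exit_rate r y.
Proof.
have [x xy] := nontrivial y; rewrite eq_sym in xy.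
have [z [yz _ zy]] := dist_step xy.
rewrite (exit_rateE r_ge0 succ_uniq r_succ) big_mkcond.
rewrite (bigD1_seq z) ?rate_succ//= zy.
by apply: (le_trans yz); rewrite lerDl sumr_ge0// => v _; case: ifP.
Qed.

Lemma exit_rate_le_Rmax y : exit_rate r y <= Rmax.
Proof.
rewrite (exit_rateE r_ge0 succ_uniq r_succ); apply: le_trans (rate_le y).
by rewrite [leRHS](bigID (fun z => z != y))/= lerDl sumr_ge0.
Qed.

(* Subtracting a multiple of the bounded function [theta ^+ dist], whose drift
   is positive except at [x], turns a negative drift outside a finite set into
   a negative drift outside [x]. *)
Lemma irreducible_foster : positive_recurrent r.
Proof.
move=> x; have t0 := theta_gt0 x; have t1 := theta_le1 x.
have [c reachc] := reach_in x.
have distc y : (dist x y <= h y + c)%N.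
  by have [k [kle yx]] := reachc y; exact: leq_trans (dist_le yx) kle.
(* Where [h] is at least [n0], the drift of [V] is at most -1 already. Elsewhere [dist] is at most
   [n0 + c], so [theta ^+ dist] has drift at least [w] off [x], and [K * w = |C| + 1] cancels [C]
   and leaves -1. *)
pose n0 := Num.bound ((C + 1) / eps).
have n0P : C + 1 <= eps * n0%:R.
  by rewrite mulrC -ler_pdivrMr// ltW// unstable.ltr_bound.
pose w := theta ^+ (n0 + c) * (rmin / 2).
have w0 : 0 < w by rewrite !mulr_gt0 ?exprn_gt0 ?invr_gt0.
pose K := (`|C| + 1) / w.
have K0 : 0 <= K by rewrite divr_ge0 ?addr_ge0// ltW.
pose W y := V y + K * (1 - theta ^+ dist x y).
apply: (@foster_recurrent_state _ _ r succ r_ge0 succ_uniq r_succ x W rmin Rmax) => //.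
- exact: rmin_le_exit_rate.
- exact: exit_rate_le_Rmax.
- by move=> y; rewrite addr_ge0// mulr_ge0// subr_ge0 exprn_ile1// ltW.
move=> y yx; have Vy := V_drift y; have ty := theta_drift yx.
have -> : \sum_(z <- succ y) r y z * (W z - W y) =
    \sum_(z <- succ y) r y z * (V z - V y) -
    K * \sum_(z <- succ y) r y z * (theta ^+ dist x z - theta ^+ dist x y).
  rewrite mulr_sumr -sumrB; apply: eq_bigr => z _; rewrite /W; ring.
have g0 : 0 <= theta ^+ (dist x y).-1 * (rmin / 2).
  by rewrite mulr_ge0 ?exprn_ge0// ltW// divr_gt0.
have [nh|hn] := leqP n0 (h y).
  have : eps * n0%:R <= eps * (h y)%:R by rewrite ler_wpM2l ?ler_nat// ltW.
  have := mulr_ge0 K0 (le_trans g0 ty); lra.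
have Kw : K * w = `|C| + 1 by rewrite /K mulfVK// gt_eqF.
have : K * w <= K * \sum_(z <- succ y) r y z *
    (theta ^+ dist x z - theta ^+ dist x y).
  rewrite ler_wpM2l//; apply: le_trans ty; rewrite ler_wpM2r ?divr_ge0 ?(ltW rmin_gt0)//.
  rewrite ler_wiXn2l// ?(ltW t0)//; apply: (leq_trans (leq_pred _)).
  by apply: (leq_trans (distc y)); rewrite leq_add2r ltnW.
rewrite Kw; have : 0 <= eps * (h y)%:R by rewrite mulr_ge0// ltW.
have := ler_norm C; lra.
Qed.

End FosterIrreducible.

(** * Occupancy sequences *)

Section Occupancy.
Local Open Scope nat_scope.

Definition occ_valid (q : seq nat) : bool := sorted geq q && (0 \notin q).

(** Validity read on the zero-padded sequence, whose entry [j] is Q_{j+1}. The second clause makes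
    the entries determine the list. *)
Lemma occ_valid_nth (q : seq nat) : (occ_valid q) <->
  (forall j, nth 0 q j.+1 <= nth 0 q j) /\ (forall j, (0 < nth 0 q j) = (j < size q)).
Proof.
split=> [/andP[sq q0]|[qd qp]].
  have qp j : (0 < nth 0 q j) = (j < size q).
    case: (ltnP j (size q)) => jq; last by rewrite nth_default.
    by rewrite lt0n; apply: contraNneq q0 => <-; exact: mem_nth.
  split=> // j; case: (ltnP j.+1 (size q)) => jq; last by rewrite nth_default.
  by move/(sortedP 0) : sq => /(_ j jq).
apply/andP; split; first by apply/(sortedP 0) => j _; exact: qd.
by apply/negP => /(nthP 0)[j jq q0]; have := qp j; rewrite q0 jq.
Qed.

(** The zeros of a nonincreasing list are trailing, and removing them does not affect the
    zero-padded sequence. *)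
Lemma nth_filter_pos (q : seq nat) j : sorted geq q ->
  nth 0 [seq n <- q | 0 < n] j = nth 0 q j.
Proof.
elim: q j => //= n q IH j nq; case: posnP => [n0|n_gt0].
  have z : all (pred1 0) (n :: q).
    rewrite /= n0 eqxx /=; move: nq; rewrite n0 path_sortedE; last first.
      by move=> a b c /= ab bc; exact: leq_trans bc ab.
    by move=> /andP[/allP h _]; apply/allP => a /h /=; rewrite leqn0.
  rewrite [in RHS](all_pred1P _ _ z) nth_nseq if_same.
  rewrite (_ : [seq n <- q | 0 < n] = [::]) ?nth_nil//.
  apply/eqP; rewrite -[_ == _]negbK -has_filter; apply/hasPn => a aq.
  by move: z => /= /andP[_ /allP/(_ a aq)/= /eqP->].
by case: j => //= j; apply: IH; exact: path_sorted nq.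
Qed.

Lemma occ_departure_sorted (q : seq nat) j : occ_valid q -> nth 0 q j.+1 < nth 0 q j ->
  sorted geq (set_nth 0 q j (nth 0 q j).-1).
Proof.
move=> /occ_valid_nth[qd qp] qj; apply/(sortedP 0) => i _; rewrite !nth_set_nth /=.
by have := qd i; do 2 case: eqP => ?; subst; lia.
Qed.

Lemma nth_occ_departure (q : seq nat) j m : occ_valid q -> nth 0 q j.+1 < nth 0 q j ->
  nth 0 (occ_departure q j.+1) m = if m == j then (nth 0 q j).-1 else nth 0 q m.
Proof.
move=> vq qj; rewrite /occ_departure nth_filter_pos ?occ_departure_sorted//.
by rewrite nth_set_nth.
Qed.

Lemma occ_departure_valid (q : seq nat) j : occ_valid q -> nth 0 q j.+1 < nth 0 q j ->
  occ_valid (occ_departure q j.+1).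
Proof.
move=> vq qj; apply/andP; split; last by rewrite mem_filter.
apply: sorted_filter; last exact: occ_departure_sorted.
by move=> a b c /= ab bc; exact: leq_trans bc ab.
Qed.

Lemma occ_arrival_valid (q : seq nat) j : occ_valid q ->
  (j == 0) || (nth 0 q j < nth 0 q j.-1) -> occ_valid (occ_arrival q j).
Proof.
move=> /occ_valid_nth[qd qp] qj; apply/occ_valid_nth; split=> m.
  rewrite !nth_incr_nth; have := qd m.
  by case: eqP => ?; case: eqP => ?; subst; move: qj => /=; lia.
rewrite nth_incr_nth addn_gt0 lt0b qp size_incr_nth.
have jq : j <= size q.
  case: j qj => [|j] //=; rewrite -qp; lia.
by case: (ltnP j (size q)) => jq'; lia.
Qed.

End Occupancy.

(** * Additive functionals of the queue lengths *)

Section WeightedSum.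
Context {R : realType}.
Implicit Types (q : seq nat) (f : nat -> R).

(** A server with [k] tasks contributes [f 0 + ... + f k.-1], so any additive cost of the queue
    lengths has this form. *)
Definition wsum f q : R := \sum_(m < size q) f m * (nth 0%N q m)%:R.

Lemma wsumE f q n : (size q <= n)%N -> wsum f q = \sum_(m < n) f m * (nth 0%N q m)%:R.
Proof.
move=> qn; rewrite /wsum -!(big_mkord xpredT (fun m => f m * (nth 0%N q m)%:R)).
rewrite [RHS](@big_cat_nat _ _ _ (size q))//=.
rewrite [X in _ = _ + X]big_nat_cond [X in _ = _ + X]big1 ?addr0// => m.
by move=> /andP[/andP[qm _] _]; rewrite nth_default// mulr0.
Qed.

Lemma wsum_update f q q' j (v : R) :
  (forall m, (nth 0%N q' m)%:R = (nth 0%N q m)%:R + (if m == j then v else 0)) ->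
  wsum f q' = wsum f q + f j * v.
Proof.
move=> qq'; pose n := maxn (maxn (size q) (size q')) j.+1.
have jn : (j < n)%N by rewrite /n; lia.
rewrite (@wsumE f q n) ?(@wsumE f q' n) ?/n; try lia.
rewrite -/n (bigD1 (Ordinal jn))//= [in RHS](bigD1 (Ordinal jn))//= qq' eqxx.
rewrite mulrDr -!addrA; congr (_ + _); rewrite addrC; congr (_ + _).
apply: eq_bigr => i ij; rewrite qq' ifF ?addr0//.
by apply: contraNF ij => /eqP e; apply/eqP/val_inj.
Qed.

Lemma wsum_arrival f q j : wsum f (occ_arrival q j) = wsum f q + f j.
Proof.
rewrite (@wsum_update f q _ j 1) ?mulr1// => m.
by rewrite nth_incr_nth eq_sym natrD addrC; case: eqP.
Qed.

Lemma wsum_departure f q j : occ_valid q -> (nth 0 q j.+1 < nth 0 q j)%N ->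
  wsum f (occ_departure q j.+1) = wsum f q - f j.
Proof.
move=> vq qj; rewrite (@wsum_update f q _ j (-1)) ?mulrN1// => m.
rewrite nth_occ_departure//; case: eqP => [->|]; last by rewrite addr0.
by rewrite -subn1 natrB//; lia.
Qed.

(** The number of servers with exactly [j.+1] tasks. *)
Definition level q j : R := (nth 0%N q j - nth 0%N q j.+1)%N%:R.

Lemma levelE q j : occ_valid q -> level q j = (nth 0%N q j)%:R - (nth 0%N q j.+1)%:R.
Proof. by move=> /occ_valid_nth[qd _]; rewrite /level natrB. Qed.

Lemma sum_level q : occ_valid q -> \sum_(j < size q) level q j = (nth 0%N q 0)%:R.
Proof.
move=> vq; have : \sum_(j < size q) level q j =
    (nth 0%N q 0)%:R - (nth 0%N q (size q))%:R.
  elim: (size q) => [|n IH]; first by rewrite big_ord0 subrr.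
  by rewrite big_ord_recr /= IH levelE//; lra.
by rewrite [nth _ _ (size q)]nth_default// subr0.
Qed.

(** Summation by parts: the tasks are counted by server on the left and by position in the queue on
    the right. *)
Lemma sum_level_index q : occ_valid q ->
  \sum_(j < size q) level q j * j.+1%:R = wsum (fun=> 1) q.
Proof.
move=> vq; have : \sum_(j < size q) level q j * j.+1%:R =
    \sum_(m < size q) 1 * (nth 0%N q m)%:R - (size q)%:R * (nth 0%N q (size q))%:R.
  elim: (size q) => [|n IH]; first by rewrite !big_ord0; lra.
  by rewrite !big_ord_recr /= IH levelE// -natr1; ring.
by rewrite [nth _ _ (size q)]nth_default// mulr0 subr0.
Qed.

Lemma wsum1E q : wsum (fun=> 1) q = (sumn q)%:R.
Proof.
rewrite /wsum sumnE (big_nth 0%N) big_mkord natr_sum; apply: eq_bigr => i _.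
by rewrite mul1r.
Qed.

End WeightedSum.

(** * The generator of the TABS chain *)

Section Generator.
Context {R : realType}.
Variables (lambda mu nu : R) (N : nat).
Hypotheses (lambda_gt0 : 0 < lambda) (mu_gt0 : 0 < mu) (nu_gt0 : 0 < nu).

Notation trans := (tabs_transitions lambda mu nu N).

Lemma tabs_configE q d0 d1 : tabs_config N (q, d0, d1) =
  occ_valid q && (occ q 1 + d0 + d1 <= N)%N.
Proof. by rewrite /tabs_config /occ_valid andbA. Qed.

Lemma sum_iota1 n (g : nat -> R) : \sum_(i <- iota 1 n) g i = \sum_(j < n) g j.+1.
Proof.
rewrite (iotaDl 1 0 n) big_map -(big_mkord xpredT (fun j => g j.+1)).
by rewrite /index_iota subn0.
Qed.

Lemma level_neq0 (q : seq nat) j :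
  (level q j != 0 :> R) = (nth 0 q j.+1 < nth 0 q j)%N.
Proof. by rewrite pnatr_eq0 -lt0n subn_gt0. Qed.

Definition setup_start (d0 d1 : nat) : nat * nat :=
  if (0 < d0)%N then (d0.-1, d1.+1) else (d0, d1).

Lemma tabs_arrivalsE q d0 d1 : tabs_arrivals lambda N (q, d0, d1) =
  if (0 < idle_on N (q, d0, d1))%N then
    [:: (lambda * N%:R, (occ_arrival q 0, d0, d1))]
  else if occ q 1 == 0%N then
    [:: (lambda * N%:R, (q, (setup_start d0 d1).1, (setup_start d0 d1).2))]
  else [seq (lambda * N%:R * (level q i.-1 / (occ q 1)%:R),
             (occ_arrival q i, (setup_start d0 d1).1, (setup_start d0 d1).2))
           | i <- iota 1 (size q)].
Proof.
rewrite /tabs_arrivals /setup_start; case: ifP => // _.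
case: (ltnP 0 d0) => _ /=; case: ifP => // _.
  apply/eq_in_map => i; rewrite mem_iota => /andP[i0 _]; rewrite /= /level.
  by case: i i0.
by apply/eq_in_map => i; rewrite mem_iota => /andP[i0 _]; rewrite /level; case: i i0.
Qed.

Lemma tabs_departuresE q d0 d1 : tabs_departures (q, d0, d1) =
  [seq (level q i.-1 : R, (occ_departure q i, d0, d1)) | i <- iota 1 (size q)].
Proof.
by apply/eq_in_map => i; rewrite mem_iota => /andP[i0 _]; rewrite /level; case: i i0.
Qed.

Lemma setup_startD d0 d1 :
  ((setup_start d0 d1).1 + (setup_start d0 d1).2 = d0 + d1)%N.
Proof. by rewrite /setup_start; case: ltnP => /= h; lia. Qed.

Lemma tabs_rates_ge0 c e : e \in trans c -> 0 <= e.1.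
Proof.
case: c => [[q d0] d1]; rewrite /tabs_transitions !mem_cat => /or3P[].
- rewrite tabs_arrivalsE; case: ifP => _; last case: ifP => _.
  + by rewrite inE => /eqP->; rewrite mulr_ge0// ltW.
  + by rewrite inE => /eqP->; rewrite mulr_ge0// ltW.
  + by move=> /mapP[i _ ->] /=; rewrite !mulr_ge0 ?divr_ge0// ltW.
- by rewrite tabs_departuresE => /mapP[i _ ->] /=.
- by rewrite !inE => /orP[] /eqP-> /=; rewrite mulr_ge0// ltW.
Qed.

(** The transition lists contain entries of rate 0 whose target may be no state, such as a
    switch-off when no server is idle-on. *)
Lemma tabs_transitions_valid c e : tabs_config N c -> e \in trans c -> e.1 != 0 ->
  tabs_config N e.2.
Proof.
case: c => [[q d0] d1]; rewrite tabs_configE => /andP[vq qN].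
have [qd qp] := (occ_valid_nth q).1 vq.
rewrite /tabs_transitions !mem_cat => /or3P[].
- rewrite tabs_arrivalsE; case: ifP => u0; last case: ifP => b0.
  + rewrite inE => /eqP-> _; rewrite tabs_configE occ_arrival_valid//.
    by move: u0; rewrite /idle_on /occ /occ_arrival nth_incr_nth; lia.
  + rewrite inE => /eqP-> _; rewrite tabs_configE vq/=.
    by have := setup_startD d0 d1; lia.
  + move=> /mapP[[|i]]; rewrite mem_iota => /andP[] // _ _ ->.
    rewrite [_.1]/= !mulf_eq0 !negb_or => /andP[_ /andP[+ _]]; rewrite level_neq0 => qi.
    change (tabs_config N
      (occ_arrival q i.+1, (setup_start d0 d1).1, (setup_start d0 d1).2)).
    rewrite tabs_configE occ_arrival_valid ?qi ?orbT// /occ /occ_arrival nth_incr_nth.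
    by move: qN (setup_startD d0 d1); rewrite /occ/=; lia.
- rewrite tabs_departuresE => /mapP[[|i]]; rewrite mem_iota => /andP[] // _ _ ->.
  rewrite [_.1]/= level_neq0 => qi.
  change (tabs_config N (occ_departure q i.+1, d0, d1)); rewrite tabs_configE.
  rewrite occ_departure_valid// /occ nth_occ_departure//=.
  by move: qN; rewrite /occ/=; case: eqP => [<-|_]; lia.
- rewrite !inE => /orP[] /eqP-> /=; rewrite mulf_eq0 negb_or !pnatr_eq0 => /andP[_ h].
    by rewrite andbA -/(occ_valid q) vq; move: h; rewrite /=; lia.
  by rewrite andbA -/(occ_valid q) vq/=; lia.
Qed.

Definition tabs_succ (y : tabs_state N) : seq (tabs_state N) :=
  undup (pmap insub [seq e.2 | e <- trans (val y)]).

Notation rate := (tabs_rate lambda mu nu).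

Lemma tabs_rate_succ (y z : tabs_state N) : z \notin tabs_succ y -> rate y z = 0.
Proof.
rewrite mem_undup mem_pmap_sub => zs; rewrite /tabs_rate big_seq_cond big1// => e.
by move=> /andP[et /eqP ez]; case/negP: zs; apply/mapP; exists e.
Qed.

Lemma tabs_rate_ge0 (y z : tabs_state N) : 0 <= rate y z.
Proof.
rewrite /tabs_rate big_seq_cond; apply: sumr_ge0 => e /andP[et _].
exact: tabs_rates_ge0 et.
Qed.

(** Entries with a common target are merged in [tabs_rate], and those without a target state have
    rate 0; hence the generator can be computed on the list itself. *)
Lemma sum_tabs_rate (y : tabs_state N) (F : config -> R) :
  \sum_(z <- tabs_succ y) rate y z * F (val z) = \sum_(e <- trans (val y)) e.1 * F e.2.
Proof.
rewrite /tabs_rate.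
transitivity (\sum_(z <- tabs_succ y) \sum_(e <- trans (val y) | e.2 == val z)
    e.1 * F e.2).
  by apply: eq_bigr => z _; rewrite mulr_suml; apply: eq_bigr => e /eqP->.
rewrite (exchange_big_dep xpredT)//= big_seq [RHS]big_seq; apply: eq_bigr => e et.
have [e0|e0] := eqVneq e.1 0; first by rewrite e0 mul0r big1// => z _; rewrite mul0r.
have ve := tabs_transitions_valid (valP y) et e0.
pose z0 : tabs_state N := Sub e.2 ve.
have z0s : z0 \in tabs_succ y.
  by rewrite mem_undup mem_pmap_sub /= map_f.
rewrite big_mkcond (bigD1_seq z0) ?undup_uniq//= eqxx big1 ?addr0// => z zz0.
by case: eqP => // ez; case/eqP: zz0; apply/val_inj; rewrite /= -ez.
Qed.

Lemma sum_departures (F : config -> R) q d0 d1 :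
  \sum_(e <- tabs_departures (q, d0, d1)) e.1 * F e.2 =
  \sum_(j < size q) level q j * F (occ_departure q j.+1, d0, d1).
Proof. by rewrite tabs_departuresE big_map sum_iota1. Qed.

Lemma total_rate_le c : tabs_config N c ->
  \sum_(e <- trans c) e.1 <= (lambda + 1 + mu + nu) * N%:R.
Proof.
case: c => [[q d0] d1]; rewrite tabs_configE => /andP[vq qN].
rewrite /tabs_transitions !big_cat.
have N0 : 0 <= lambda * N%:R by rewrite mulr_ge0// ltW.
have -> : (lambda + 1 + mu + nu) * N%:R =
  lambda * N%:R + (N%:R + (mu * N%:R + nu * N%:R)) by ring.
apply: lerD; last apply: lerD.
- rewrite tabs_arrivalsE; case: ifP => _; first by rewrite big_seq1.
  case: ifP => b0; first by rewrite big_seq1.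
  rewrite big_map sum_iota1 /= -mulr_sumr -mulr_suml sum_level//.
  by rewrite divff ?mulr1// pnatr_eq0 /= -/(occ q 1) b0.
- rewrite tabs_departuresE big_map sum_iota1 /= sum_level// ler_nat.
  by move: qN; rewrite /occ/=; lia.
- rewrite big_cons big_seq1 /= lerD// ler_wpM2l ?ler_nat ?(ltW mu_gt0)
    ?(ltW nu_gt0)//; lia.
Qed.

Definition rate_min : R := Num.min (Num.min lambda 1) (Num.min mu nu).

Lemma rate_min_gt0 : 0 < rate_min.
Proof. by rewrite !lt_min lambda_gt0 ltr01 mu_gt0. Qed.

Lemma sum_tabs_rate_le (y : tabs_state N) :
  \sum_(z <- tabs_succ y) rate y z <= (lambda + 1 + mu + nu) * N%:R.
Proof.
rewrite (eq_bigr (fun z => rate y z * 1)) => [|z _]; last by rewrite mulr1.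
rewrite (sum_tabs_rate y (fun=> 1)) (eq_bigr (fun e => e.1)) => [|e _].
  exact/total_rate_le/valP.
by rewrite mulr1.
Qed.

Variable phi : R -> R -> R -> R -> R.
Variable Phi : R.

Definition state_phi (c : config) : R :=
  let: (q, d0, d1) := c in
  phi (occ q 1)%:R (idle_on N c)%:R d0%:R d1%:R.

Hypothesis phi_ge0 : forall c, 0 <= state_phi c.
Hypothesis phi_le : forall c, tabs_config N c -> state_phi c <= Phi.

(* [wsum (fun m => m%:R + 2^-1) q] is half the sum of the squared queue lengths
   and [wsum (fun=> 1) q] is the number of tasks. *)
Definition lyap (c : config) : R :=
  wsum (fun m => m%:R + 2^-1) c.1.1 + wsum (fun=> 1) c.1.1 * state_phi c.

(* [w] is the number of servers with exactly one task. *)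
Definition drift (b u d0 d1 w : R) : R :=
  let p := phi b u d0 d1 in
  (if 0 < u then lambda * N%:R * (phi (b + 1) (u - 1) d0 d1 - p)
   else lambda * N%:R * (b^-1 +
     (if 0 < d0 then phi b u (d0 - 1) (d1 + 1) - p else 0)))
  - 1 + w * (phi (b - 1) (u + 1) d0 d1 - p)
  + mu * u * (phi b (u - 1) (d0 + 1) d1 - p)
  + nu * d1 * (phi b (u + 1) d0 (d1 - 1) - p).

Lemma lyap_switches q d0 d1 (M := wsum (fun=> 1) q : R)
    (b := (occ q 1)%:R) (u := (idle_on N (q, d0, d1))%:R) :
  tabs_config N (q, d0, d1) ->
  \sum_(e <- tabs_switches mu nu N (q, d0, d1)) e.1 * (lyap e.2 - lyap (q, d0, d1)) =
  M * (mu * u * (phi b (u - 1) (d0%:R + 1) d1%:R - phi b u d0%:R d1%:R)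
     + nu * d1%:R * (phi b (u + 1) d0%:R (d1%:R - 1) - phi b u d0%:R d1%:R)).
Proof.
rewrite tabs_configE => /andP[vq qN].
rewrite /tabs_switches big_cons big_seq1.
change (mu * u * (lyap (q, d0.+1, d1) - lyap (q, d0, d1)) +
  nu * d1%:R * (lyap (q, d0, d1.-1) - lyap (q, d0, d1)) = M *
  (mu * u * (phi b (u - 1) (d0%:R + 1) d1%:R - phi b u d0%:R d1%:R) +
   nu * d1%:R * (phi b (u + 1) d0%:R (d1%:R - 1) - phi b u d0%:R d1%:R))).
(* Truncated and real subtraction agree only if there is a server to move; otherwise the rate is
   0. *)
have off : (0 < idle_on N (q, d0, d1))%N ->
    state_phi (q, d0.+1, d1) = phi b (u - 1) (d0%:R + 1) d1%:R.
  move=> u0; rewrite /state_phi natr1; congr (phi _ _ _ _).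
  rewrite (_ : idle_on _ _ = (idle_on N (q, d0, d1) - 1)%N); first by rewrite natrB.
  by rewrite /idle_on; lia.
have setup : (0 < d1)%N -> state_phi (q, d0, d1.-1) = phi b (u + 1) d0%:R (d1%:R - 1).
  move=> d1_gt0.
  have -> : d1%:R - 1 = d1.-1%:R :> R by rewrite -subn1 natrB.
  rewrite /state_phi; congr (phi _ _ _ _).
  by rewrite /u natr1; congr (_%:R); rewrite /idle_on; lia.
rewrite [RHS]mulrDr /lyap -/M; congr (_ + _).
  have [u0|/off ->] := posnP (idle_on N (q, d0, d1)).
    by rewrite /u u0 mulr0 !mul0r mulr0.
  by rewrite -/M /state_phi -/b -/u; ring.
have [d10|/setup ->] := posnP d1; first by rewrite d10 !mulr0 !mul0r mulr0.
by rewrite -/M /state_phi -/b -/u; ring.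
Qed.

(** A departure from a queue of length [j + 1] lowers the quadratic part by [j + 1/2], which sums to
    [M - b / 2]. It also turns [M * p] into [(M - 1) * p'], where [- p'] is dropped as [phi] is
    nonnegative. Only [j = 0] changes the arguments of [phi]. *)
Lemma lyap_departures q d0 d1 (M := wsum (fun=> 1) q : R)
    (b := (occ q 1)%:R) (u := (idle_on N (q, d0, d1))%:R) :
  tabs_config N (q, d0, d1) ->
  \sum_(e <- tabs_departures (q, d0, d1)) e.1 * (lyap e.2 - lyap (q, d0, d1)) <=
  b / 2 - M + M * (level q 0 *
    (phi (b - 1) (u + 1) d0%:R d1%:R - phi b u d0%:R d1%:R)).
Proof.
rewrite tabs_configE => /andP[vq qN].
rewrite (sum_departures (fun c => lyap c - lyap (q, d0, d1))).
set X := phi _ _ _ _ - _.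
apply: (@le_trans _ _ (\sum_(j < size q)
    (level q j / 2 - level q j * j.+1%:R +
     (if j == 0%N :> nat then M * (level q 0 * X) else 0)))).
  apply: ler_sum => j _; have [lj|lj] := eqVneq (level q j : R) 0.
    rewrite lj !mul0r subrr add0r; case: eqP => // j0.
    by rewrite -j0 lj mul0r mulr0.
  have qj : (nth 0 q j.+1 < nth 0 q j)%N by rewrite -level_neq0.
  have -> : level q j / 2 - level q j * j.+1%:R +
      (if j == 0%N :> nat then M * (level q 0 * X) else 0) =
    level q j * (2^-1 - j.+1%:R + (if j == 0%N :> nat then M * X else 0)).
    by case: eqP => [->|_]; ring.
  apply: ler_wpM2l => //; rewrite /lyap [_.1.1]/= [(q, d0, d1).1.1]/=.
  rewrite !wsum_departure// -/M.
  have := phi_ge0 (occ_departure q j.+1, d0, d1).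
  set p' := state_phi (occ_departure _ _, _, _).
  have -> : (if j == 0%N :> nat then M * X else 0) = M * (p' - state_phi (q, d0, d1)).
    rewrite /p' /= /X -/u /occ nth_occ_departure//=; case: eqP => [j0|/eqP j0].
      move: qj; rewrite j0 eqxx => q0.
      have -> : (nth 0%N q 0).-1%:R = b - 1 :> R.
        by rewrite -subn1 natrB//; case: (nth 0%N q 0) q0.
      have -> : (N - ((nth 0 q 0).-1 + d0 + d1))%N%:R = u + 1 :> R.
        by rewrite /u natr1; congr (_%:R); move: q0 qN; rewrite /idle_on /occ /=; lia.
      by [].
    by rewrite eq_sym (negPf j0) -!/(occ q 1) subrr mulr0.
  by cbv beta; rewrite -[j.+1%:R]natr1; lra.
rewrite big_split sumrB -mulr_suml sum_level// sum_level_index// lerD2l.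
case: (posnP (size q)) => [/size0nil q0|q0].
  by rewrite q0 big_ord0 /M q0 /wsum big_ord0 mul0r.
by rewrite (bigD1 (Ordinal q0))//= big1 ?addr0// => i; rewrite -val_eqE /= => /negPf->.
Qed.

Lemma lyapE q d0 d1 : lyap (q, d0, d1) =
  wsum (fun m => m%:R + 2^-1) q + wsum (fun=> 1) q * state_phi (q, d0, d1).
Proof. by []. Qed.

Lemma wsum0 f q : occ_valid q -> occ q 1 = 0%N -> wsum f q = 0 :> R.
Proof.
move=> /occ_valid_nth[_ /(_ 0%N)]; rewrite /occ /= => + q0; rewrite q0 => /esym/negbT.
by rewrite -leqNgt leqn0 => /nilP->; rewrite /wsum big_ord0.
Qed.

Lemma Phi_ge0 : 0 <= Phi.
Proof. by apply: le_trans (phi_ge0 ([::], 0%N, 0%N)) (phi_le _). Qed.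

(** An arrival at a queue of length [j + 1] raises the quadratic part by [j + 3/2], on average over
    the busy servers [M / b + 1/2]: this is the source of [b^-1]. The new task adds one value of
    [phi], at most [Phi]. *)
Lemma lyap_arrivals q d0 d1 (M := wsum (fun=> 1) q : R)
    (b := (occ q 1)%:R) (u := (idle_on N (q, d0, d1))%:R) :
  tabs_config N (q, d0, d1) ->
  \sum_(e <- tabs_arrivals lambda N (q, d0, d1)) e.1 * (lyap e.2 - lyap (q, d0, d1)) <=
  lambda * N%:R * (2^-1 + Phi) + M * (lambda * N%:R *
    if 0 < u then phi (b + 1) (u - 1) d0%:R d1%:R - phi b u d0%:R d1%:R
    else b^-1 + if 0 < d0%:R :> R
                then phi b u (d0%:R - 1) (d1%:R + 1) - phi b u d0%:R d1%:R else 0).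
Proof.
move=> vc; have := vc; rewrite tabs_configE => /andP[vq qN].
have N0 : 0 <= lambda * N%:R by rewrite mulr_ge0// ltW.
rewrite tabs_arrivalsE !ltr0n; case: ifP => [u0|].
  rewrite big_seq1.
  change (lambda * N%:R * (lyap (occ_arrival q 0, d0, d1) - lyap (q, d0, d1)) <=
    lambda * N%:R * (2^-1 + Phi) + M * (lambda * N%:R *
    (phi (b + 1) (u - 1) d0%:R d1%:R - phi b u d0%:R d1%:R))).
  have vc' : tabs_config N (occ_arrival q 0, d0, d1).
    rewrite tabs_configE occ_arrival_valid//.
    by move: u0; rewrite /idle_on /occ /occ_arrival nth_incr_nth; lia.
  have := phi_le vc'.
  have p'E : state_phi (occ_arrival q 0, d0, d1) = phi (b + 1) (u - 1) d0%:R d1%:R.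
    rewrite /state_phi; congr (phi _ _ _ _).
      by rewrite /occ /occ_arrival nth_incr_nth natrD addrC.
    rewrite (_ : idle_on _ _ = (idle_on N (q, d0, d1) - 1)%N); first by rewrite natrB.
    by rewrite /idle_on /occ /occ_arrival nth_incr_nth; lia.
  rewrite p'E => p'le; rewrite mulrCA -mulrDr ler_wpM2l//.
  rewrite !lyapE !wsum_arrival -/M p'E.
  have -> : state_phi (q, d0, d1) = phi b u d0%:R d1%:R by [].
  by lra.
move=> /negbT; rewrite -leqNgt leqn0 => /eqP u0.
have Phi0 := Phi_ge0; case: ifP => b0.
  have M0 : M = 0 by apply: wsum0 => //; exact/eqP.
  rewrite big_seq1.
  change (lambda * N%:R * (lyap (q, (setup_start d0 d1).1, (setup_start d0 d1).2) -
    lyap (q, d0, d1)) <= lambda * N%:R * (2^-1 + Phi) + M * (lambda * N%:R * 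
    (b^-1 + if (0 < d0)%N then phi b u (d0%:R - 1) (d1%:R + 1) - phi b u d0%:R d1%:R
            else 0))).
  rewrite /lyap -/M M0 !mul0r subrr mulr0 addr0 mulr_ge0//; lra.
set X := if (0 < d0)%N then _ else _.
have b_gt0 : 0 < b by rewrite ltr0n lt0n b0.
rewrite big_map sum_iota1.
apply: (@le_trans _ _ (\sum_(j < size q) lambda * N%:R / b * (level q j * j.+1%:R +
    level q j * (2^-1 + Phi + M * X)))).
  apply: ler_sum => j _.
  change (lambda * N%:R * (level q j / b) *
    (lyap (occ_arrival q j.+1, (setup_start d0 d1).1, (setup_start d0 d1).2) -
     lyap (q, d0, d1)) <=
    lambda * N%:R / b * (level q j * j.+1%:R + level q j * (2^-1 + Phi + M * X))).
  have -> : lambda * N%:R * (level q j / b) = lambda * N%:R / b * level q j by ring.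
  rewrite -mulrA ler_wpM2l ?divr_ge0 ?(ltW b_gt0)//.
  have [->|lj] := eqVneq (level q j : R) 0; first by rewrite !mul0r addr0.
  have qj : (nth 0 q j.+1 < nth 0 q j)%N by rewrite -level_neq0.
  rewrite -mulrDr ler_wpM2l//.
  have occE : occ (occ_arrival q j.+1) 1 = occ q 1.
    by rewrite /occ /occ_arrival nth_incr_nth.
  have vc' : tabs_config N
      (occ_arrival q j.+1, (setup_start d0 d1).1, (setup_start d0 d1).2).
    rewrite tabs_configE occ_arrival_valid ?qj ?orbT// occE.
    by move: (setup_startD d0 d1) qN; lia.
  have := phi_le vc'; set p' := state_phi _ => p'le.
  have -> : X = p' - state_phi (q, d0, d1).
    rewrite /p' /state_phi occE -/b.
    have -> : idle_on N
        (occ_arrival q j.+1, (setup_start d0 d1).1, (setup_start d0 d1).2) =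
        idle_on N (q, d0, d1).
      by rewrite /idle_on occE; move: (setup_startD d0 d1); lia.
    rewrite -/u /X /setup_start; case: ltnP => [d0_gt0|_] /=; last by rewrite subrr.
    by rewrite -natr1 -subn1 natrB.
  by rewrite !lyapE -/p' !wsum_arrival -/M; lra.
rewrite -mulr_sumr big_split/= sum_level_index// -mulr_suml sum_level//.
rewrite -/(occ q 1) -/b -/M.
rewrite le_eqVlt; apply/orP; left; apply/eqP; field; exact: lt0r_neq0.
Qed.

Lemma lyap_drift q d0 d1 (M := wsum (fun=> 1) q : R)
    (b := (occ q 1)%:R) (u := (idle_on N (q, d0, d1))%:R) :
  tabs_config N (q, d0, d1) ->
  \sum_(e <- trans (q, d0, d1)) e.1 * (lyap e.2 - lyap (q, d0, d1)) <=
  M * drift b u d0%:R d1%:R (level q 0) + N%:R * (lambda * (2^-1 + Phi) + 2^-1).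
Proof.
move=> vc; rewrite /tabs_transitions !big_cat.
have ha := lyap_arrivals vc; have hd := lyap_departures vc.
have hs := lyap_switches vc.
have bN : b <= N%:R.
  by rewrite ler_nat; move: vc; rewrite tabs_configE => /andP[_]; lia.
apply: (le_trans (lerD ha (lerD hd (lexx _)))); rewrite hs.
rewrite -/M -/b -/u /drift; clear ha hd hs; case: ifP => _; first by lra.
by set Z := _^-1 + (if _ then _ else _); lra.
Qed.

End Generator.

(** * The function phi *)

Section Saturation.
Context {R : realType}.
Implicit Types h u : R.

(* A smooth version of [Num.min u h], whose kink would spoil the drift of
   [ell] below. *)
Definition rho h u : R := u * h / (u + h).

Lemma rho_incE h u : 0 < h -> 0 <= u ->
  rho h (u + 1) - rho h u = h ^+ 2 / ((u + h) * (u + 1 + h)).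
Proof. by move=> h0 u0; rewrite /rho; field; rewrite !gt_eqF//; lra. Qed.

Lemma rho_inc_ge0 h u : 0 < h -> 0 <= u -> 0 <= rho h (u + 1) - rho h u.
Proof. by move=> h0 u0; rewrite rho_incE// divr_ge0 ?sqr_ge0// mulr_ge0//; lra. Qed.

Lemma rho_inc_le1 h u : 0 < h -> 0 <= u -> rho h (u + 1) - rho h u <= 1.
Proof.
by move=> h0 u0; rewrite rho_incE// ler_pdivrMr ?mul1r ?mulr_gt0//; nra.
Qed.

(** Keeps the bonus lost by idle-on servers switching off, at total rate [mu * u], below [mu * h]
    for every [u]; likewise for setups that end. *)
Lemma rho_dec_rate h u : 0 < h -> 1 <= u -> u * (rho h u - rho h (u - 1)) <= h.
Proof.
move=> h0 u1; have := @rho_incE h (u - 1) h0; rewrite subrK => ->; last by lra.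
rewrite mulrA ler_pdivrMr ?mulr_gt0//; try lra.
rewrite expr2 mulrCA ler_wpM2l//; first by lra.
by rewrite mulrC; apply: ler_pM; lra.
Qed.

(** An arrival gives up the increment below [u] and a departure earns the one above [u]; this
    controls the mismatch. *)
Lemma rho_inc_diff h u : 0 < h -> 1 <= u ->
  (rho h u - rho h (u - 1)) - (rho h (u + 1) - rho h u) <= 2 / h.
Proof.
move=> h0 u1; have := @rho_incE h (u - 1) h0; rewrite subrK => ->; last by lra.
rewrite rho_incE//; last by lra.
have -> : h ^+ 2 / ((u - 1 + h) * (u + h)) - h ^+ 2 / ((u + h) * (u + 1 + h)) =
   2 * h ^+ 2 / ((u - 1 + h) * (u + h) * (u + 1 + h)).
  by field; rewrite !gt_eqF//; lra.
rewrite ler_pdivrMr ?mulr_gt0//; try lra.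
rewrite -[leRHS]mulrA ler_wpM2l// ler_pdivlMl// -exprS.
have -> : h ^+ 3 = h * h * h by ring.
apply: ler_pM; rewrite ?mulr_ge0//; try lra.
by apply: ler_pM; lra.
Qed.

Lemma rho_ge0 h u : 0 < h -> 0 <= u -> 0 <= rho h u.
Proof. by move=> h0 u0; rewrite divr_ge0 ?mulr_ge0//; lra. Qed.

Lemma rho_le h u : 0 < h -> 0 <= u -> rho h u <= h.
Proof. by move=> h0 u0; rewrite ler_pdivrMr; nra. Qed.

Lemma rho_inc0 h : 0 < h -> 1 - (rho h (0 + 1) - rho h 0) <= h^-1.
Proof.
move=> h0; rewrite rho_incE//.
have -> : 1 - h ^+ 2 / ((0 + h) * (0 + 1 + h)) = (1 + h)^-1.
  by field; rewrite !gt_eqF//; lra.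
by rewrite lef_pV2 ?posrE//; lra.
Qed.

(** The denominator factors are at most [2 * h] and [3 * h]. *)
Lemma rho_inc_ge h u : 1 <= h -> 0 <= u -> u <= h -> 6^-1 <= rho h (u + 1) - rho h u.
Proof.
move=> h1 u0 uh; rewrite rho_incE//; last by lra.
by rewrite ler_pdivlMr ?mulr_gt0//; nra.
Qed.

(** From [1 - y <= expR (- y)] one gets [expR y <= (1 - y)^-1], which is below the quadratic for
    these [y]. *)
Lemma expR_le_quad (y : R) : y <= 2^-1 -> expR y <= 1 + y + 2 * y ^+ 2.
Proof.
move=> y1; have y10 : 0 < 1 - y by lra.
have := expR_ge1Dx (- y); rewrite expRN => h.
have /le_trans : expR y <= (1 - y)^-1.
  by rewrite -[leLHS]invrK lef_pV2 ?posrE// invr_gt0 expR_gt0.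
by apply; rewrite -div1r ler_pdivrMr//; have := sqr_ge0 y; nra.
Qed.

Lemma expR_increment (c l l' : R) : 0 < c -> c <= 2^-1 -> l' - l <= 1 -> -1 <= l' - l ->
  expR (- (c * l')) - expR (- (c * l)) <=
  expR (- (c * l)) * (- (c * (l' - l)) + 2 * c ^+ 2).
Proof.
move=> c0 c1 h1 h2.
have -> : - (c * l') = - (c * l) + - (c * (l' - l)) by ring.
rewrite expRD -[X in _ - X]mulr1 -mulrBr ler_wpM2l ?expR_ge0//.
have : - (c * (l' - l)) <= 2^-1 by nra.
move/expR_le_quad; rewrite sqrrN exprMn.
have D1 : (l' - l) ^+ 2 <= 1 by nra.
have := ler_wpM2l (sqr_ge0 c) D1; lra.
Qed.

End Saturation.

(** * Drift of the occupancy numbers under an arbitrary control [w] *)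

Section OccupancyDrift.
Context {R : realType}.
Variables (lambda mu nu n : R).
Hypotheses (lambda_gt0 : 0 < lambda) (lambda_lt1 : lambda < 1).
Hypotheses (mu_gt0 : 0 < mu) (nu_gt0 : 0 < nu) (n_ge1 : 1 <= n).

Definition gen (f : R -> R -> R -> R -> R) (b u d0 d1 w : R) : R :=
  (if 0 < u then lambda * n * (f (b + 1) (u - 1) d0 d1 - f b u d0 d1)
   else if 0 < d0 then lambda * n * (f b u (d0 - 1) (d1 + 1) - f b u d0 d1) else 0)
  + w * (f (b - 1) (u + 1) d0 d1 - f b u d0 d1)
  + mu * u * (f b (u - 1) (d0 + 1) d1 - f b u d0 d1)
  + nu * d1 * (f b (u + 1) d0 (d1 - 1) - f b u d0 d1).

(* All that is needed of the integrality of the occupancy numbers. *)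
Definition whole (x : R) : Prop := x = 0 \/ 1 <= x.

Variables (b u d0 d1 w : R).
Hypotheses (b_ge0 : 0 <= b) (cu : whole u) (cd0 : whole d0) (cd1 : whole d1).
Hypotheses (sumN : b + u + d0 + d1 = n) (w_ge0 : 0 <= w) (wb : w <= b).

Lemma whole_ge0 (x : R) : whole x -> 0 <= x. Proof. by case; lra. Qed.

Lemma whole_gt0 (x : R) : whole x -> (0 < x) = (1 <= x).
Proof. by case=> h; apply/idP/idP; lra. Qed.

Variables (s t h k : R).
Hypotheses (s_ge0 : 0 <= s) (s_le1 : s <= 1) (t_ge0 : 0 <= t) (t_le1 : t <= 1).
Hypotheses (h_gt0 : 0 < h) (k_gt0 : 0 < k).

Definition ell (b u d0 d1 : R) : R := b + s * rho h u + t * rho k d1.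

Variable c : R.
Hypotheses (c_gt0 : 0 < c) (c_le : c <= 2^-1).
Definition zeta (b u d0 d1 : R) : R := expR (- (c * ell b u d0 d1)).

Definition total_rate : R := lambda + 1 + mu + nu.

Let uge0 : 0 <= u. Proof. exact: whole_ge0. Qed.
Let d0ge0 : 0 <= d0. Proof. exact: whole_ge0. Qed.
Let d1ge0 : 0 <= d1. Proof. exact: whole_ge0. Qed.

Lemma zeta_step (l l' : R) : l' - l <= 1 -> -1 <= l' - l ->
  expR (- (c * l')) - expR (- (c * l)) <=
  expR (- (c * l)) * (- (c * (l' - l)) + 2 * c ^+ 2).
Proof. by move=> h1 h2; exact: expR_increment. Qed.

Lemma ell_arrival : 1 <= u -> ell (b + 1) (u - 1) d0 d1 - ell b u d0 d1 =
  1 - s * (rho h u - rho h (u - 1)).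
Proof. by rewrite /ell => _; ring. Qed.

Lemma ell_departure : ell (b - 1) (u + 1) d0 d1 - ell b u d0 d1 =
  - 1 + s * (rho h (u + 1) - rho h u).
Proof. by rewrite /ell; ring. Qed.

Lemma ell_off : ell b (u - 1) (d0 + 1) d1 - ell b u d0 d1 =
  - (s * (rho h u - rho h (u - 1))).
Proof. by rewrite /ell; ring. Qed.

Lemma ell_setup_end : ell b (u + 1) d0 (d1 - 1) - ell b u d0 d1 =
  s * (rho h (u + 1) - rho h u) - t * (rho k d1 - rho k (d1 - 1)).
Proof. by rewrite /ell; ring. Qed.

Lemma ell_setup_start : ell b u (d0 - 1) (d1 + 1) - ell b u d0 d1 =
  t * (rho k (d1 + 1) - rho k d1).
Proof. by rewrite /ell; ring. Qed.

Lemma rho_dec_bounds (x y : R) : 0 < x -> 1 <= y ->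
  0 <= rho x y - rho x (y - 1) /\ rho x y - rho x (y - 1) <= 1.
Proof.
move=> x0 y1; have y0 : 0 <= y - 1 by lra.
by have := rho_inc_ge0 x0 y0; have := rho_inc_le1 x0 y0; rewrite subrK.
Qed.

Lemma zeta_rate (r l' : R) (l := ell b u d0 d1) : 0 <= r ->
  (r = 0 \/ (l' - l <= 1 /\ -1 <= l' - l)) ->
  r * (expR (- (c * l')) - expR (- (c * l))) <=
  expR (- (c * l)) * (- c * (r * (l' - l)) + 2 * c ^+ 2 * r).
Proof.
move=> r0 [->|[h1 h2]]; first by rewrite !mul0r !mulr0 addr0 mulr0.
have := ler_wpM2l r0 (zeta_step h1 h2); lra.
Qed.

Lemma prod_unit (x y : R) : 0 <= x <= 1 -> 0 <= y <= 1 -> 0 <= x * y <= 1.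
Proof. by move=> /andP[? ?] /andP[? ?]; rewrite mulr_ge0// mulr_ile1. Qed.

(** Each jump changes [ell] by at most 1, so the second-order error is at most [2 * c ^+ 2] times
    the total jump rate. *)
Lemma gen_zeta_le : gen zeta b u d0 d1 w <=
  zeta b u d0 d1 * (- c * gen ell b u d0 d1 w + 2 * c ^+ 2 * (total_rate * n)).
Proof.
move: lambda_gt0 mu_gt0 nu_gt0 n_ge1 uge0 d0ge0 d1ge0 b_ge0 w_ge0 wb sumN => *.
have s01 : 0 <= s <= 1 by rewrite s_ge0.
have t01 : 0 <= t <= 1 by rewrite t_ge0.
have inc (x y : R) : 0 < x -> 0 <= y -> 0 <= rho x (y + 1) - rho x y <= 1.
  by move=> x0 y0; rewrite rho_inc_ge0 ?rho_inc_le1.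
have dec (x y : R) : 0 < x -> 1 <= y -> 0 <= rho x y - rho x (y - 1) <= 1.
  by move=> x0 y1; have [-> ->] := rho_dec_bounds x0 y1.
have z0 : 0 <= zeta b u d0 d1 by exact: expR_ge0.
have ha : (if 0 < u then lambda * n * (zeta (b + 1) (u - 1) d0 d1 - zeta b u d0 d1)
   else if 0 < d0 then lambda * n * (zeta b u (d0 - 1) (d1 + 1) - zeta b u d0 d1)
   else 0) <= zeta b u d0 d1 * (- c *
   (if 0 < u then lambda * n * (ell (b + 1) (u - 1) d0 d1 - ell b u d0 d1)
   else if 0 < d0 then lambda * n * (ell b u (d0 - 1) (d1 + 1) - ell b u d0 d1)
   else 0) + 2 * c ^+ 2 * (lambda * n)).
  have ln : 0 <= lambda * n by rewrite mulr_ge0//; lra.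
  rewrite (whole_gt0 cu); case: ifP => u1.
    apply: zeta_rate => //; right; rewrite ell_arrival//.
    by have /andP[? ?] := prod_unit s01 (dec _ _ h_gt0 u1); split; lra.
  case: ifP => _; last first.
    by rewrite mulr0 add0r mulr_ge0// mulr_ge0// mulr_ge0// sqr_ge0.
  apply: zeta_rate => //; right; rewrite ell_setup_start.
  by have /andP[? ?] := prod_unit t01 (inc _ _ k_gt0 d1ge0); split; lra.
have hd : w * (zeta (b - 1) (u + 1) d0 d1 - zeta b u d0 d1) <= zeta b u d0 d1 *
    (- c * (w * (ell (b - 1) (u + 1) d0 d1 - ell b u d0 d1)) + 2 * c ^+ 2 * w).
  apply: zeta_rate => //; right; rewrite ell_departure.
  by have /andP[? ?] := prod_unit s01 (inc _ _ h_gt0 uge0); split; lra.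
have ho : mu * u * (zeta b (u - 1) (d0 + 1) d1 - zeta b u d0 d1) <= zeta b u d0 d1 *
    (- c * (mu * u * (ell b (u - 1) (d0 + 1) d1 - ell b u d0 d1)) +
     2 * c ^+ 2 * (mu * u)).
  apply: zeta_rate; first by rewrite mulr_ge0// ltW.
  case: cu => [->|u1]; first by left; rewrite mulr0.
  right; rewrite ell_off.
  by have /andP[? ?] := prod_unit s01 (dec _ _ h_gt0 u1); split; lra.
have hs : nu * d1 * (zeta b (u + 1) d0 (d1 - 1) - zeta b u d0 d1) <= zeta b u d0 d1 *
    (- c * (nu * d1 * (ell b (u + 1) d0 (d1 - 1) - ell b u d0 d1)) +
     2 * c ^+ 2 * (nu * d1)).
  apply: zeta_rate; first by rewrite mulr_ge0// ltW.
  case: cd1 => [->|d11]; first by left; rewrite mulr0.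
  right; rewrite ell_setup_end.
  have /andP[? ?] := prod_unit s01 (inc _ _ h_gt0 uge0).
  by have /andP[? ?] := prod_unit t01 (dec _ _ k_gt0 d11); split; lra.
have tot : lambda * n + w + mu * u + nu * d1 <= total_rate * n.
  have mun : mu * u <= mu * n by rewrite ler_wpM2l ?(ltW mu_gt0)//; lra.
  have nun : nu * d1 <= nu * n by rewrite ler_wpM2l ?(ltW nu_gt0)//; lra.
  by rewrite /total_rate; lra.
have cc : 0 <= 2 * c ^+ 2 by rewrite mulr_ge0// sqr_ge0.
have := ler_wpM2l z0 (ler_wpM2l cc tot).
rewrite /gen; move: ha hd ho hs.
set za := (if _ then _ else _); set la := (if _ then _ else _); lra.
Qed.

Lemma gen_ell_ge : - (total_rate * n) <= gen ell b u d0 d1 w.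
Proof.
move: lambda_gt0 mu_gt0 nu_gt0 n_ge1 uge0 d0ge0 d1ge0 b_ge0 w_ge0 wb sumN => *.
have s01 : 0 <= s <= 1 by rewrite s_ge0.
have t01 : 0 <= t <= 1 by rewrite t_ge0.
have inc (x y : R) : 0 < x -> 0 <= y -> 0 <= rho x (y + 1) - rho x y <= 1.
  by move=> x0 y0; rewrite rho_inc_ge0 ?rho_inc_le1.
have dec (x y : R) : 0 < x -> 1 <= y -> 0 <= rho x y - rho x (y - 1) <= 1.
  by move=> x0 y1; have [-> ->] := rho_dec_bounds x0 y1.
have ln : 0 <= lambda * n by rewrite mulr_ge0//; lra.
have ha : 0 <= (if 0 < u then lambda * n * (ell (b + 1) (u - 1) d0 d1 - ell b u d0 d1)
   else if 0 < d0 then lambda * n * (ell b u (d0 - 1) (d1 + 1) - ell b u d0 d1)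
   else 0).
  rewrite (whole_gt0 cu); case: ifP => u1.
    rewrite mulr_ge0// ell_arrival//.
    by have /andP[? ?] := prod_unit s01 (dec _ _ h_gt0 u1); lra.
  case: ifP => // _; rewrite mulr_ge0// ell_setup_start.
  by have /andP[? ?] := prod_unit t01 (inc _ _ k_gt0 d1ge0); lra.
have hd : - w <= w * (ell (b - 1) (u + 1) d0 d1 - ell b u d0 d1).
  rewrite -[leLHS]mulrN1 ler_wpM2l// ell_departure.
  by have /andP[? ?] := prod_unit s01 (inc _ _ h_gt0 uge0); lra.
have ho : - (mu * u) <= mu * u * (ell b (u - 1) (d0 + 1) d1 - ell b u d0 d1).
  case: cu => [->|u1]; first by rewrite mulr0 mul0r oppr0.
  rewrite -[leLHS]mulrN1 ler_wpM2l ?ell_off//; first by rewrite mulr_ge0 ?(ltW mu_gt0).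
  by have /andP[? ?] := prod_unit s01 (dec _ _ h_gt0 u1); lra.
have hs : - (nu * d1) <= nu * d1 * (ell b (u + 1) d0 (d1 - 1) - ell b u d0 d1).
  case: cd1 => [->|d11]; first by rewrite mulr0 mul0r oppr0.
  rewrite -[leLHS]mulrN1 ler_wpM2l ?ell_setup_end//.
    by rewrite mulr_ge0 ?(ltW nu_gt0).
  have /andP[? ?] := prod_unit s01 (inc _ _ h_gt0 uge0).
  by have /andP[? ?] := prod_unit t01 (dec _ _ k_gt0 d11); lra.
have mun : mu * u <= mu * n by rewrite ler_wpM2l ?(ltW mu_gt0)//; lra.
have nun : nu * d1 <= nu * n by rewrite ler_wpM2l ?(ltW nu_gt0)//; lra.
rewrite /gen /total_rate; move: ha hd ho hs.
set la := (if _ then _ else _); lra.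
Qed.

Variables (sg l0 : R).
Hypotheses (sg_gt0 : 0 < sg) (sg_le : sg <= 96^-1).
Hypotheses (s_def : s = 1 - sg) (t_def : t = 24 * sg).
Hypotheses (l0_lt : l0 < lambda) (b_le : b <= l0 * n) (k_ge1 : 1 <= k).
Hypotheses (h_large : 2 / h <= (lambda - l0) * sg / 4).
Hypotheses (h_small : mu * h <= (lambda - l0) * sg / 4 * n).
Hypotheses (k_small : nu * (t * k) <= (lambda - l0) * sg / 4 * n).
Hypotheses (k_small' : k <= (1 - lambda) * n) (sg_small : 8 * sg * lambda * n <= nu * k).

(** With an idle-on server, the excess of arrivals over departures gains at least [4 * c1 * n];
    concavity, switch-offs and ending setups each take back at most [c1 * n]. Without one,
    departures cost at most [2 * sg * lambda * n], and setups earn at least twice that. *)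
Lemma gen_ell_ge_pos : 0 <= l0 -> (lambda - l0) * sg / 4 * n <= gen ell b u d0 d1 w.
Proof.
move: lambda_gt0 lambda_lt1 mu_gt0 nu_gt0 n_ge1 uge0 d0ge0 d1ge0 b_ge0 w_ge0 wb sumN => *.
move: sg_gt0 sg_le l0_lt b_le k_ge1 s_ge0 s_le1 t_ge0 t_le1 => *.
set c1 := (lambda - l0) * sg / 4.
have inc (x y : R) : 0 < x -> 0 <= y -> 0 <= rho x (y + 1) - rho x y <= 1.
  by move=> x0 y0; rewrite rho_inc_ge0 ?rho_inc_le1.
have dec (x y : R) : 0 < x -> 1 <= y -> 0 <= rho x y - rho x (y - 1) <= 1.
  by move=> x0 y1; have [-> ->] := rho_dec_bounds x0 y1.
have n0 : 0 <= n by lra.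
have d1dec : d1 * (t * (rho k d1 - rho k (d1 - 1))) <= t * k.
  rewrite mulrCA; apply: ler_wpM2l => //.
  case: cd1 => [->|d11]; first by rewrite mul0r ltW.
  exact: rho_dec_rate.
case: cu => [u0|u1].
  have wln : w <= lambda * n.
    by apply: (le_trans wb); apply: (le_trans b_le); rewrite ler_wpM2r// ltW.
  have m0 : 1 - s * (rho h (u + 1) - rho h u) <= 2 * sg.
    rewrite u0; have := rho_inc0 h_gt0; set m := rho _ _ - _ => hm.
    have h2 : h^-1 <= sg.
      have : (lambda - l0) * sg / 4 <= 1 * sg / 4.
        by rewrite ler_wpM2r// ler_wpM2r//; lra.
      by have := h_large; lra.
    have : sg * m <= sg * 1.
      by rewrite ler_wpM2l ?(ltW sg_gt0)// /m; have /andP[] := inc _ 0 h_gt0 (lexx 0).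
    have m1 : 1 - m <= sg by lra.
    have : 0 <= sg * m.
      by rewrite mulr_ge0 ?(ltW sg_gt0)// /m; have /andP[] := inc _ 0 h_gt0 (lexx 0).
    rewrite s_def; lra.
  have wm : w * (1 - s * (rho h (u + 1) - rho h u)) <= lambda * n * (2 * sg).
    apply: ler_pM => //.
    by have /andP[? ?] := inc _ _ h_gt0 uge0; rewrite subr_ge0 mulr_ile1.
  have d1m : d1 / 2 <=
      d1 * (s * (rho h (u + 1) - rho h u) - t * (rho k d1 - rho k (d1 - 1))).
    case: cd1 => [->|d11]; first by rewrite !mul0r.
    apply: ler_wpM2l => //.
    have /andP[? ?] := dec _ _ k_gt0 d11.
    have : t * (rho k d1 - rho k (d1 - 1)) <= t * 1 by rewrite ler_wpM2l.
    rewrite t_def; lra.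
  have nd1m := ler_wpM2l (ltW nu_gt0) d1m.
  have goal2 : c1 * n <= 2 * sg * lambda * n.
    rewrite ler_wpM2r// /c1; have : (lambda - l0) * sg <= lambda * sg.
      by rewrite ler_wpM2r ?(ltW sg_gt0)//; lra.
    have : 0 <= lambda * sg by rewrite mulr_ge0// ltW.
    lra.
  apply: (le_trans goal2); rewrite /gen ell_departure ell_setup_end.
  have hi (y : R) : mu * u * y = 0 by rewrite u0 mulr0 mul0r.
  rewrite hi addr0 ell_setup_start.
  have -> : (0 < u) = false by rewrite u0 ltxx.
  (* With at least [k] setups, each completion gains at least 1/2, in total at least
     [nu * k / 2 >= 4 * sg * lambda * n]. *)
  case: (lerP k d1) => [kd|dk].
    have : nu * k <= nu * d1 by rewrite ler_wpM2l// ltW.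
    have arr0 : 0 <=
        (if 0 < d0 then lambda * n * (t * (rho k (d1 + 1) - rho k d1)) else 0).
      case: ifP => // _; rewrite !mulr_ge0 ?(ltW lambda_gt0)//.
      by have /andP[] := inc _ _ k_gt0 d1ge0.
    move: arr0; set la := (if _ then _ else _) => arr0.
    move: wm nd1m sg_small; set m := rho h (u + 1) - rho h u.
    set m' := rho k d1 - _; lra.
  have ndge0 : 0 <= nu * (d1 / 2) by rewrite mulr_ge0 ?divr_ge0 ?(ltW nu_gt0).
  (* Few setups and few busy servers leave an idle-off one, so each arrival starts a setup and gains
     at least [t / 6 = 4 * sg]; hence the factor 24 in [t]. *)
  have d0_gt0 : 0 < d0.
    have := k_small'; have : l0 * n <= lambda * n by rewrite ler_wpM2r// ltW.
    lra.
  rewrite d0_gt0.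
  have inc6 := rho_inc_ge k_ge1 d1ge0 (ltW dk).
  have : lambda * n * (t * 6^-1) <= lambda * n * (t * (rho k (d1 + 1) - rho k d1)).
    by rewrite ler_wpM2l ?mulr_ge0 ?(ltW lambda_gt0)// ler_wpM2l.
  move: wm nd1m; set m := rho h (u + 1) - rho h u.
  set m' := rho k d1 - _; set m'' := rho k (d1 + 1) - _; rewrite t_def; lra.
have u_gt0 : 0 < u by lra.
have bn : b <= n by lra.
rewrite /gen u_gt0 ell_departure ell_setup_end ell_off ell_arrival//.
have mdiff := rho_inc_diff h_gt0 u1; have mrate := rho_dec_rate h_gt0 u1.
have /andP[p0 p1] := inc _ _ h_gt0 uge0; have /andP[m0 m1] := dec _ _ h_gt0 u1.
move: mdiff mrate p0 p1 m0 m1.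
set m := rho h u - _; set p := rho h (u + 1) - _ => mdiff mrate p0 p1 m0 m1.
have sm : s * m <= s * 1 by rewrite ler_wpM2l.
(* The gain [lambda * n * (1 - s * m) - w * (1 - s * p)] is split into
   [(lambda * n - w) * (1 - s * m)] and the concavity loss [w * (s * (m - p))]. *)
have arr : (lambda * n - w) * sg <= (lambda * n - w) * (1 - s * m).
  apply: ler_wpM2l; last by rewrite s_def in sm *; lra.
  have : l0 * n <= lambda * n by rewrite ler_wpM2r// ltW.
  lra.
have arr' : (lambda - l0) * n * sg <= (lambda * n - w) * sg.
  by rewrite ler_wpM2r ?(ltW sg_gt0)//; lra.
have dif : w * (s * (m - p)) <= n * ((lambda - l0) * sg / 4).
  have mp : s * (m - p) <= 2 / h.
    have [mp0|mp0] := leP 0 (m - p).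
      by apply: le_trans mdiff; rewrite ler_piMl.
    have : s * (m - p) <= 0 by rewrite mulr_ge0_le0// ltW.
    have : 0 <= 2 / h by rewrite divr_ge0// ltW.
    lra.
  apply: (@le_trans _ _ (w * ((lambda - l0) * sg / 4))).
    by rewrite ler_wpM2l//; apply: le_trans mp h_large.
  by rewrite ler_wpM2r ?divr_ge0 ?mulr_ge0//; lra.
have off : mu * u * (s * m) <= (lambda - l0) * sg / 4 * n.
  apply: le_trans h_small; rewrite -mulrA ler_wpM2l ?(ltW mu_gt0)// mulrCA.
  apply: le_trans mrate; rewrite ler_piMl// mulr_ge0//.
have sd : 0 <= nu * d1 * (s * p) by rewrite !mulr_ge0// ltW.
have sd' : nu * (d1 * (t * (rho k d1 - rho k (d1 - 1)))) <= (lambda - l0) * sg / 4 * n.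
  by apply: le_trans k_small; rewrite ler_wpM2l// ltW.
move: sd'; set q := rho k d1 - _; rewrite /c1; lra.
Qed.

End OccupancyDrift.

(** * The potential [phi] and its drift *)

Section PhiDrift.
Context {R : realType}.
Implicit Types lambda mu nu : R.

(** Switching off costs two units, and one is regained at the start and one at the end of a setup.
    Dividing by [n] makes the drift of order 1. *)
Definition setup_cost (a n : R) (b u d0 d1 : R) : R := a * (d1 + 2 * d0) / n.

Definition phi_fun (a n A : R) (z : R -> R -> R -> R -> R) (b u d0 d1 : R) : R :=
  setup_cost a n b u d0 d1 + A * z b u d0 d1.

Lemma driftE lambda mu nu (N : nat) phi (b u d0 d1 w : R) :
  drift lambda mu nu N phi b u d0 d1 w =
  gen lambda mu nu N%:R phi b u d0 d1 w + (if 0 < u then 0 else lambda * N%:R / b) - 1.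
Proof. by rewrite /drift /gen; case: ifP => _; [|case: ifP => _]; ring. Qed.

Lemma gen_phi lambda mu nu n a A z (b u d0 d1 w : R) :
  gen lambda mu nu n (phi_fun a n A z) b u d0 d1 w =
  gen lambda mu nu n (setup_cost a n) b u d0 d1 w +
  A * gen lambda mu nu n z b u d0 d1 w.
Proof. by rewrite /gen /phi_fun; case: ifP => _; [|case: ifP => _]; ring. Qed.

Lemma gen_setup_cost lambda mu nu n a (b u d0 d1 w : R) : 0 < n ->
  gen lambda mu nu n (setup_cost a n) b u d0 d1 w =
  if 0 < u then 2 * a * mu * (u / n) - a * nu * (d1 / n)
  else (if 0 < d0 then - (a * lambda) else 0) + 2 * a * mu * (u / n) - a * nu * (d1 / n).
Proof.
move=> n0; rewrite /gen /setup_cost; case: ifP => _; [|case: ifP => _]; field;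
  exact: lt0r_neq0.
Qed.

Section Zeta.
Variables (lambda mu nu n b u d0 d1 w sg eta kappa l0 c : R).
Let c1 := (lambda - l0) * sg / 4.
Let C := total_rate lambda mu nu.
Let z := zeta (1 - sg) (24 * sg) (eta * n) (kappa * n) c.

(** The choice of [c] makes the second-order term [2 * c ^+ 2 * C * n] half of the first-order gain
    [c * c1 * n]. *)
Lemma gen_zeta_bounds :
  0 < lambda -> lambda < 1 -> 0 < mu -> 0 < nu -> 1 <= n ->
  0 <= b -> whole u -> whole d0 -> whole d1 -> b + u + d0 + d1 = n ->
  0 <= w -> w <= b ->
  0 < sg -> sg <= 96^-1 -> 0 < l0 -> l0 < lambda ->
  0 < eta -> mu * eta <= c1 ->
  0 < kappa -> kappa <= 1 - lambda -> 96 * nu * kappa <= lambda - l0 ->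
  8 * sg * lambda <= nu * kappa ->
  1 <= kappa * n -> 2 / (eta * n) <= c1 ->
  c = c1 / (4 * C) ->
  gen lambda mu nu n z b u d0 d1 w <= C * n * z b u d0 d1 /\
  (b <= l0 * n -> gen lambda mu nu n z b u d0 d1 w <= - (c * c1 / 2 * n * z b u d0 d1)).
Proof.
move=> lam0 lam1 mu0 nu0 n1 b0 cu cd0 cd1 sumN w0 wb sg0 sg1 l00 l0l eta0 etac kap0 kap1.
move=> kapn sgk kn hn cE.
have n0 : 0 < n by lra.
have C1 : 1 <= C by rewrite /C /total_rate; lra.
have C0 : 0 < C by lra.
have c10 : 0 < c1 by rewrite /c1 divr_gt0 ?mulr_gt0//; lra.
have c1le : c1 <= 1.
  rewrite /c1; have : (lambda - l0) * sg <= 1 * 1 by apply: ler_pM; lra.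
  lra.
have c0 : 0 < c by rewrite cE divr_gt0// mulr_gt0.
have cC : c * C = c1 / 4 by rewrite cE; field; exact: lt0r_neq0.
have c_le : c <= 4^-1.
  by rewrite cE ler_pdivrMr ?mulr_gt0//; lra.
have h0 : 0 < eta * n by rewrite mulr_gt0.
have k0 : 0 < kappa * n by rewrite mulr_gt0.
have s0 : 0 <= 1 - sg by lra.
have s1 : 1 - sg <= 1 by lra.
have t0 : 0 <= 24 * sg by lra.
have t1 : 24 * sg <= 1 by lra.
have ch : c <= 2^-1 by lra.
have gz := gen_zeta_le lam0 mu0 nu0 n1 b0 cu cd0 cd1 sumN w0 wb s0 s1 t0 t1 h0 k0 c0 ch.
have ge := gen_ell_ge lam0 mu0 nu0 n1 b0 cu cd0 cd1 sumN w0 wb s0 s1 t0 t1 h0 k0.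
have z0 : 0 <= z b u d0 d1 by exact: expR_ge0.
have Cn : 0 <= C * n by rewrite mulr_ge0 ?(ltW C0) ?(ltW n0).
have cc : c ^+ 2 <= c * 4^-1 by rewrite expr2 ler_wpM2l// ltW.
split.
  apply: (le_trans gz); rewrite mulrC ler_wpM2r//.
  have := ler_wpM2l (ltW c0) ge; have := ler_wpM2r Cn cc; have := ler_wpM2r Cn c_le.
  by rewrite -/C; lra.
move=> bl0; apply: (le_trans gz).
have pos : c1 * n <= gen lambda mu nu n
    (ell (1 - sg) (24 * sg) (eta * n) (kappa * n)) b u d0 d1 w.
  apply: (gen_ell_ge_pos lam0 lam1 mu0 nu0 n1 b0 cu cd0 cd1 sumN w0 wb s0 s1 t0 t1 h0 k0
    sg0 sg1 erefl erefl l0l bl0 kn hn); rewrite ?(ltW l00)//.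
  - by rewrite mulrA ler_wpM2r// ltW.
  - rewrite !mulrA ler_wpM2r ?(ltW n0)//.
    have := ler_wpM2r (ltW sg0) kapn; lra.
  - by rewrite ler_wpM2r// ltW.
  - by rewrite [leRHS]mulrA ler_wpM2r// ltW.
rewrite -[leRHS]mulNr [leRHS]mulrC ler_wpM2l//.
have := ler_wpM2l (ltW c0) pos; rewrite -/C.
have -> : 2 * c ^+ 2 * (C * n) = 2 * c * n * (c * C) by ring.
rewrite cC; lra.
Qed.

End Zeta.

Lemma ell_bounds (sg h k e b u d0 d1 : R) : 0 <= sg -> sg <= 96^-1 -> 0 < h -> 0 < k ->
  h <= e / 8 -> k <= e / 2 -> 0 <= u -> 0 <= d1 ->
  b <= ell (1 - sg) (24 * sg) h k b u d0 d1 <= b + e / 4.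
Proof.
move=> sg0 sg1 h0 k0 he ke u0 d10.
have r1 : 0 <= (1 - sg) * rho h u by rewrite mulr_ge0 ?rho_ge0//; lra.
have r2 : 0 <= 24 * sg * rho k d1 by rewrite mulr_ge0 ?rho_ge0//; lra.
have r3 : (1 - sg) * rho h u <= 1 * h.
  by apply: ler_pM; rewrite ?rho_ge0 ?rho_le//; lra.
have r4 : 24 * sg * rho k d1 <= 4^-1 * k.
  by apply: ler_pM; rewrite ?rho_ge0 ?rho_le//; lra.
by rewrite /ell; apply/andP; split; lra.
Qed.

(** [Z] stands for the drift of the exponential term. The critical case is [u = 0] and [b > l1 * n]:
    the load [lambda * n / b] exceeds 1 by at most [q / 2] and [Z] adds at most [q / 4], so a
    further gain of [q] is needed. If a server is idle-off, arrivals starting setups provide it. *)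
Lemma drift_le_of_zeta lambda mu nu a q l1 n (b u d0 d1 Z : R) :
  0 < lambda -> lambda < 1 -> 0 < mu -> 0 < nu -> 0 < n ->
  1 <= b -> whole u -> whole d0 -> 0 <= d1 -> b + u + d0 + d1 = n ->
  0 < a -> a * mu <= 8^-1 ->
  0 < q -> q <= a * lambda -> q <= a * nu * (1 - lambda) / 2 -> q <= (1 - lambda) / 2 ->
  lambda = l1 * (1 + q / 2) -> Z <= q / 4 -> (b <= l1 * n -> Z <= - (lambda * n)) ->
  (if 0 < u then 2 * a * mu * (u / n) - a * nu * (d1 / n)
   else (if 0 < d0 then - (a * lambda) else 0) + 2 * a * mu * (u / n) - a * nu * (d1 / n))
  + Z + (if 0 < u then 0 else lambda * n / b) - 1 <= - (q / 4).
Proof.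
move=> lam0 lam1 mu0 nu0 n0 b1 cu cd0 d10 sumN a0 amu q0 qa qnu q1 l1E Zle Zneg.
have u0 := whole_ge0 cu; have d00 := whole_ge0 cd0.
have b_gt0 : 0 < b := lt_le_trans ltr01 b1.
have un1 : u / n <= 1 by rewrite ler_pdivrMr//; lra.
have dn0 : 0 <= a * nu * (d1 / n).
  by rewrite !mulr_ge0 ?invr_ge0 ?(ltW a0) ?(ltW nu0) ?(ltW n0).
have amu0 : 0 <= a * mu by rewrite mulr_ge0 ?(ltW a0) ?(ltW mu0).
case: ifP => [u_gt0|u_le0].
  have : 2 * a * mu * (u / n) <= 2 * a * mu * 1.
    by rewrite ler_wpM2l//; lra.
  lra.
have uE : u = 0 by case: cu => // u1; move: u_le0; lra.
rewrite uE mul0r mulr0 addr0.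
have [bl|lb] := leP b (l1 * n).
  have neg := Zneg bl.
  have : lambda * n / b <= lambda * n.
    by rewrite ler_pdivrMr ?(lt_le_trans ltr01 b1)// ler_peMr// mulr_ge0// ltW.
  have : (if 0 < d0 then - (a * lambda) else 0) <= 0.
    by case: ifP => // _; rewrite oppr_le0 mulr_ge0 ?(ltW a0) ?(ltW lam0).
  set X := (if _ then _ else _); lra.
case: ifP => [d0_gt0|d0_le0].
  have : lambda * n / b <= 1 + q / 2.
    rewrite ler_pdivrMr// l1E mulrAC mulrC ler_wpM2l ?(ltW lb)//.
    by rewrite addr_ge0 ?divr_ge0// ltW.
  lra.
have d0E : d0 = 0 by case: cd0 => // d01; move: d0_le0; lra.
have d1E : d1 = n - b by lra.
(* All servers are busy or in setup: either enough are busy for the load to be at most [1 - q], or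
   at least [(1 - lambda) / 2 * n] are in setup and their completions gain [q]. *)
have [bbig|bsmall] := leP ((1 + lambda) / 2 * n) b.
  have : lambda * n / b <= 1 - (1 - lambda) / 2.
    rewrite ler_pdivrMr//.
    have : (1 + lambda) / 2 * ((1 + lambda) / 2 * n) <= (1 + lambda) / 2 * b.
      by rewrite ler_wpM2l//; lra.
    have : 0 <= (1 - lambda) ^+ 2 * n by rewrite mulr_ge0 ?sqr_ge0 ?(ltW n0).
    lra.
  lra.
have : lambda * n / b <= 1 + q / 2.
  rewrite ler_pdivrMr// l1E mulrAC mulrC ler_wpM2l ?(ltW lb)//.
  by rewrite addr_ge0 ?divr_ge0// ltW.
have : a * nu * ((1 - lambda) / 2) <= a * nu * (d1 / n).
  rewrite ler_wpM2l ?mulr_ge0 ?(ltW a0) ?(ltW nu0)// ler_pdivlMr// d1E; lra.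
lra.
Qed.

(** The amplitude centres the exponential at the midpoint of [l1 * n] and [l0 * n]. The bonuses in
    [ell] use up at most half of the distance from [l1 * n] to it, so the exponent is at least
    [c * (lambda - l0) / 4 * n] below [l1 * n] and at most [- (c * (lambda - l0) / 2 * n)] above
    [l0 * n]. *)
Lemma phi_drift_le lambda mu nu a q l1 l0 sg eta kappa c (N : nat) (b u d0 d1 w : R)
    (n := N%:R) (C := total_rate lambda mu nu) (c1 := (lambda - l0) * sg / 4) :
  0 < lambda -> lambda < 1 -> 0 < mu -> 0 < nu -> 1 <= n ->
  1 <= b -> whole u -> whole d0 -> whole d1 -> b + u + d0 + d1 = n ->
  0 <= w -> w <= b ->
  0 < a -> a * mu <= 8^-1 ->
  0 < q -> q <= a * lambda -> q <= a * nu * (1 - lambda) / 2 -> q <= (1 - lambda) / 2 ->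
  0 < l1 -> lambda = l1 * (1 + q / 2) -> l0 - l1 = lambda - l0 ->
  0 < sg -> sg <= 96^-1 -> l0 < lambda ->
  0 < eta -> mu * eta <= c1 -> eta <= (lambda - l0) / 8 ->
  0 < kappa -> kappa <= 1 - lambda -> 96 * nu * kappa <= lambda - l0 ->
  kappa <= (lambda - l0) / 2 -> 8 * sg * lambda <= nu * kappa ->
  1 <= kappa * n -> 2 / (eta * n) <= c1 ->
  c = c1 / (4 * C) ->
  lambda <= c * c1 / 2 * expR (c * (lambda - l0) / 4 * n) ->
  C * n * expR (- (c * (lambda - l0) / 2 * n)) <= q / 4 ->
  drift lambda mu nu N (phi_fun a n (expR (c * ((l1 + l0) / 2 * n)))
    (zeta (1 - sg) (24 * sg) (eta * n) (kappa * n) c)) b u d0 d1 w <= - (q / 4).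
Proof.
move=> lam0 lam1 mu0 nu0 n1 b1 cu cd0 cd1 sumN w0 wb a0 amu q0 qa qnu q1 l10 l1E l0E.
move=> sg0 sg1 l0l eta0 etac eta8 kap0 kap1 kapn kap2 sgk kn hn cE Nbig Nsmall.
have b0 : 0 <= b by lra.
have l00 : 0 < l0 by lra.
have n0 : 0 < n by lra.
have [gz gzneg] := gen_zeta_bounds lam0 lam1 mu0 nu0 n1 b0 cu cd0 cd1 sumN w0 wb
  sg0 sg1 l00 l0l eta0 etac kap0 kap1 kapn sgk kn hn cE.
have C0 : 0 < C by rewrite /C /total_rate; lra.
have c10 : 0 < c1 by rewrite /c1 divr_gt0 ?mulr_gt0//; lra.
have c0 : 0 < c by rewrite cE divr_gt0// mulr_gt0.
have u0 := whole_ge0 cu; have d00 := whole_ge0 cd0; have d10 := whole_ge0 cd1.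
rewrite driftE gen_phi gen_setup_cost// -/n.
set z := zeta _ _ _ _ _ in gz gzneg *; set A := expR (c * ((l1 + l0) / 2 * n)).
set G := gen _ _ _ _ z _ _ _ _ _ in gz gzneg *.
have A0 : 0 <= A by exact: expR_ge0.
have h0 : 0 < eta * n by rewrite mulr_gt0.
have k0 : 0 < kappa * n by rewrite mulr_gt0.
have Az : A * z b u d0 d1 = expR (c * ((l1 + l0) / 2 * n -
    ell (1 - sg) (24 * sg) (eta * n) (kappa * n) b u d0 d1)).
  by rewrite /A /z /zeta -expRD; congr expR; ring.
have /andP[ell_ge ell_le] : b <= ell (1 - sg) (24 * sg) (eta * n) (kappa * n) b u d0 d1
    <= b + (lambda - l0) * n / 4.
  apply: ell_bounds => //; first exact: ltW.
    by rewrite mulrAC ler_wpM2r ?(ltW n0).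
  by rewrite mulrAC ler_wpM2r ?(ltW n0).
have z0 : 0 <= z b u d0 d1 by exact: expR_ge0.
have cc1 : 0 <= c * c1 / 2 by apply: divr_ge0 => //; apply: mulr_ge0; exact: ltW.
have AG : A * G <= q / 4.
  have [bl|lb] := leP b (l0 * n).
    apply: (@le_trans _ _ 0); last by lra.
    rewrite mulr_ge0_le0//; apply: (le_trans (gzneg bl)).
    by rewrite oppr_le0; apply: mulr_ge0 => //; apply: mulr_ge0 => //; exact: ltW.
  apply: (le_trans _ Nsmall); apply: (@le_trans _ _ (C * n * (A * z b u d0 d1))).
    by rewrite [leRHS]mulrCA ler_wpM2l.
  rewrite Az ler_wpM2l ?mulr_ge0 ?(ltW C0) ?(ltW n0)// ler_expR.
  rewrite -[leRHS]mulNr.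
  have -> : - (c * (lambda - l0) / 2) * n = c * (- ((lambda - l0) / 2) * n) by ring.
  rewrite ler_wpM2l ?(ltW c0)//.
  have -> : (l1 + l0) / 2 = l0 - (lambda - l0) / 2 by lra.
  lra.
apply: (drift_le_of_zeta (l1 := l1)) => // bl.
have bl0 : b <= l0 * n.
  by apply: (le_trans bl); rewrite ler_wpM2r ?(ltW n0)//; lra.
apply: (le_trans (ler_wpM2l A0 (gzneg bl0))).
rewrite mulrN mulrCA Az lerN2 [leRHS]mulrAC ler_wpM2r ?(ltW n0)//.
apply: (le_trans Nbig); apply: ler_wpM2l => //.
rewrite ler_expR -!mulrA ler_wpM2l ?(ltW c0)//.
have : (l0 - l1 - (lambda - l0)) * n = 0 by rewrite l0E subrr mul0r.
lra.
Qed.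

End PhiDrift.

(** * Irreducibility *)

Section Reachability.
Context {R : realType}.
Variables (lambda mu nu : R) (N : nat).
Hypotheses (lambda_gt0 : 0 < lambda) (mu_gt0 : 0 < mu) (nu_gt0 : 0 < nu).
Hypothesis N_gt0 : (0 < N)%N.

Notation trans := (tabs_transitions lambda mu nu N).
Notation rmin := (rate_min lambda mu nu).

Definition cstep (c c' : config) : Prop :=
  exists2 e, e \in trans c & rmin <= e.1 /\ e.2 = c'.

Fixpoint cpath (k : nat) (c c' : config) : Prop :=
  if k is k'.+1 then exists c1, cstep c c1 /\ cpath k' c1 c' else c = c'.

Lemma cpath_cat k l c c1 c' : cpath k c c1 -> cpath l c1 c' -> cpath (k + l) c c'.
Proof.
elim: k c => [|k IH] c /=; first by move=> ->.
by move=> [c2 [s p]] p'; exists c2; split=> //; exact: IH.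
Qed.

Lemma cstep_path c c' : cstep c c' -> cpath 1 c c'.
Proof. by move=> s; exists c'. Qed.

Definition creach c c' := exists k, cpath k c c'.

Lemma creach_refl c : creach c c. Proof. by exists 0%N. Qed.

Lemma creach_step c1 c c' : creach c c1 -> cstep c1 c' -> creach c c'.
Proof. by move=> [k p] /cstep_path s; exists (k + 1)%N; exact: cpath_cat p s. Qed.

Lemma cpath_reach k (x y : tabs_state N) : cpath k (val x) (val y) ->
  reach (tabs_rate lambda mu nu (N := N)) rmin k x y.
Proof.
elim: k x => [|k IH] x /=; first exact: val_inj.
move=> [c [[e et [re ec]] p]].
have e0 : e.1 != 0.
  by rewrite gt_eqF// (lt_le_trans (rate_min_gt0 lambda_gt0 mu_gt0 nu_gt0)).
have vc := tabs_transitions_valid lambda_gt0 mu_gt0 nu_gt0 (valP x) et e0.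
exists (Sub e.2 vc); split; last by apply: IH; rewrite SubK ec.
apply: (le_trans re); rewrite /tabs_rate (big_rem e)//= eqxx lerDl.
rewrite big_seq_cond sumr_ge0// => e' /andP[/mem_rem e't _].
exact: tabs_rates_ge0 e't.
Qed.

Lemma rate_min_le : [/\ rmin <= lambda, rmin <= 1, rmin <= mu & rmin <= nu].
Proof. by split; rewrite /rate_min !ge_min lexx ?orbT. Qed.

Lemma rate_min_le_lambdaN : rmin <= lambda * N%:R.
Proof.
have [h _ _ _] := rate_min_le; apply: (le_trans h).
by rewrite ler_peMr ?ler1n// ltW.
Qed.

Lemma cstep_arrival q d0 d1 : (0 < idle_on N (q, d0, d1))%N ->
  cstep (q, d0, d1) (occ_arrival q 0, d0, d1).
Proof.
move=> u0; exists (lambda * N%:R, (occ_arrival q 0, d0, d1)); last first.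
  by split=> //; exact: rate_min_le_lambdaN.
by rewrite /tabs_transitions mem_cat tabs_arrivalsE u0 mem_head.
Qed.

Lemma cstep_setup_start d0 d1 : idle_on N ([::], d0.+1, d1) = 0%N ->
  cstep ([::], d0.+1, d1) ([::], d0, d1.+1).
Proof.
move=> u0; exists (lambda * N%:R, ([::], d0, d1.+1)); last first.
  by split=> //; exact: rate_min_le_lambdaN.
by rewrite /tabs_transitions mem_cat tabs_arrivalsE u0 mem_head.
Qed.

(** A given busy server is chosen with probability at least [1 / N], which the arrival rate
    compensates. With no idle-off server the arrival starts no setup. *)
Lemma cstep_arrival_busy q d1 j : tabs_config N (q, 0%N, d1) ->
  idle_on N (q, 0%N, d1) = 0%N -> (nth 0 q j.+1 < nth 0 q j)%N ->
  cstep (q, 0%N, d1) (occ_arrival q j.+1, 0%N, d1).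
Proof.
rewrite tabs_configE => /andP[vq qN] u0 qj.
have [qd qp] := (occ_valid_nth q).1 vq.
have jq : (j < size q)%N by rewrite -qp (leq_ltn_trans _ qj).
have b0 : (0 < occ q 1)%N by rewrite /occ qp (leq_ltn_trans _ jq).
exists (lambda * N%:R * (level q j / (occ q 1)%:R), (occ_arrival q j.+1, 0%N, d1)).
  rewrite /tabs_transitions mem_cat tabs_arrivalsE u0 /=.
  rewrite (gtn_eqF b0) (_ : _ \in map _ _)//.
  by apply/mapP; exists j.+1 => //; rewrite mem_iota /= add1n.
split=> //; have [h _ _ _] := rate_min_le; apply: (le_trans h).
rewrite [leRHS]/= -mulrA ler_peMr ?(ltW lambda_gt0)//.
rewrite mulrA ler_pdivlMr ?ltr0n// mul1r -natrM ler_nat.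
rewrite -[occ q 1]muln1 leq_mul//; last by rewrite subn_gt0.
by apply: leq_trans qN; rewrite addn0 leq_addr.
Qed.

Lemma cstep_departure q d0 d1 j : (nth 0 q j.+1 < nth 0 q j)%N ->
  cstep (q, d0, d1) (occ_departure q j.+1, d0, d1).
Proof.
move=> qj; exists (level q j, (occ_departure q j.+1, d0, d1)); last first.
  split=> //; have [_ h _ _] := rate_min_le; apply: (le_trans h).
  by rewrite ler1n subn_gt0.
rewrite /tabs_transitions !mem_cat tabs_departuresE; apply/or3P/Or32/mapP.
exists j.+1 => //; rewrite mem_iota /= add1n ltnS ltnNge.
by apply/negP => jq; rewrite (nth_default _ jq) in qj.
Qed.

Lemma cstep_off q d0 d1 : (0 < idle_on N (q, d0, d1))%N ->
  cstep (q, d0, d1) (q, d0.+1, d1).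
Proof.
move=> u0; exists (mu * (idle_on N (q, d0, d1))%:R, (q, d0.+1, d1)); last first.
  split=> //; have [_ _ h _] := rate_min_le; apply: (le_trans h).
  by rewrite [leRHS]/= ler_peMr ?ler1n// ltW.
by rewrite /tabs_transitions !mem_cat mem_head !orbT.
Qed.

Lemma cstep_setup_end q d0 d1 : cstep (q, d0, d1.+1) (q, d0, d1).
Proof.
exists (nu * d1.+1%:R, (q, d0, d1)); last first.
  split=> //; have [_ _ _ h] := rate_min_le; apply: (le_trans h).
  by rewrite [leRHS]/= ler_peMr ?ler1n// ltW.
by rewrite /tabs_transitions !mem_cat /tabs_switches !inE eqxx !orbT.
Qed.

Lemma occ_valid_inj q q' : occ_valid q -> occ_valid q' ->
  (forall m, nth 0 q m = nth 0 q' m)%N -> q = q'.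
Proof.
move=> /occ_valid_nth[_ qp] /occ_valid_nth[_ qp'] qq'.
apply: (@eq_from_nth _ 0%N); last by move=> i _; exact: qq'.
have h j : (j < size q)%N = (j < size q')%N by rewrite -qp -qp' qq'.
apply/eqP; rewrite eqn_leq leqNgt [X in _ && X]leqNgt.
by rewrite h ltnn -h ltnn.
Qed.

Definition base : config := ([::], N, 0%N).

(** The weights make each draining move lower it: a departure trades a task for at most one idle-on
    server, a completed setup trades 2 for 1, and a switch-off removes 1. *)
Definition size_of (c : config) : nat :=
  (3 * sumn c.1.1 + 2 * c.2 + idle_on N c)%N.

Lemma size_ofE q d0 d1 : size_of (q, d0, d1) =
  (3 * sumn q + 2 * d1 + (N - (occ q 1 + d0 + d1)))%N.
Proof. by []. Qed.

Lemma sumn_departure q j : occ_valid q -> (nth 0 q j.+1 < nth 0 q j)%N ->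
  sumn q = (sumn (occ_departure q j.+1)).+1.
Proof.
move=> vq qj; apply/eqP; rewrite -(eqr_nat R) -natr1 -!wsum1E.
by rewrite wsum_departure// subrK.
Qed.

Lemma last_level q : occ_valid q -> (0 < size q)%N ->
  (nth 0 q (size q).-1.+1 < nth 0 q (size q).-1)%N.
Proof.
move=> /occ_valid_nth[_ qp] q0; rewrite prednK// nth_default//.
by rewrite qp prednK.
Qed.

Lemma drain c : tabs_config N c -> exists k, (k <= size_of c)%N /\ cpath k c base.
Proof.
have [m] := ubnP (size_of c); elim: m c => // m IH [[q d0] d1] cm vc.
have := vc; rewrite tabs_configE => /andP[vq qN].
have [[c' [sc' vc' c'lt]]|stuck] := pselect (exists c',
    [/\ cstep (q, d0, d1) c', tabs_config N c' & (size_of c' < size_of (q, d0, d1))%N]).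
  have c'm : (size_of c' < m)%N by apply: leq_trans c'lt _; rewrite -ltnS.
  have [k [kle p]] := IH c' c'm vc'.
  by exists k.+1; split; [exact: leq_ltn_trans kle c'lt|exists c'].
have [q0|q0] := posnP (size q); last first.
  have ql := last_level vq q0; case: stuck.
  exists (occ_departure q (size q).-1.+1, d0, d1); split.
  - exact: cstep_departure.
  - rewrite tabs_configE occ_departure_valid// /occ nth_occ_departure//=.
    by move: qN; rewrite /occ /=; case: eqP => [<-|_]; lia.
  - rewrite !size_ofE [X in (_ < 3 * X + _ + _)%N](sumn_departure vq ql).
    rewrite /occ nth_occ_departure//.
    by move: qN; rewrite /occ /=; case: eqP => [<-|_]; lia.
move/size0nil in q0; subst q.
case: d1 {cm} vc qN stuck => [|d1] vc qN stuck; last first.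
  case: stuck; exists ([::], d0, d1); split; first exact: cstep_setup_end.
    by move: qN; rewrite tabs_configE /occ /=; lia.
  by rewrite /size_of /=; lia.
have [u0|u0] := posnP (idle_on N ([::], d0, 0%N)); last first.
  case: stuck; exists ([::], d0.+1, 0%N); split; first exact: cstep_off.
    by move: u0; rewrite tabs_configE /idle_on /occ /=; lia.
  by move: u0; rewrite /size_of /=; lia.
exists 0%N; split=> //=; congr (_, _, _).
by move: u0 qN; rewrite /idle_on /occ /=; lia.
Qed.

Definition line b : seq nat := if b is 0%N then [::] else [:: b].

(** With no busy server, arrivals are lost but start setups. All servers are brought into setup, all
    but [d1] setups end, and [b] arrivals take idle-on servers. *)
Lemma reach_line b d1 : (b + d1 <= N)%N -> creach base (line b, 0%N, d1).
Proof.
move=> bN; have s1 i : (i <= N)%N -> creach base ([::], (N - i)%N, i).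
  elim: i => [|i IH] iN; first by rewrite subn0; exact: creach_refl.
  apply: creach_step (IH (ltnW iN)) _; rewrite -(subnSK iN).
  by apply: cstep_setup_start; rewrite /idle_on /occ /=; lia.
have s2 i : (i <= N)%N -> creach base ([::], 0%N, (N - i)%N).
  elim: i => [|i IH] iN; first by have := s1 N (leqnn N); rewrite subnn subn0.
  apply: creach_step (IH (ltnW iN)) _; rewrite -(subnSK iN).
  exact: cstep_setup_end.
elim: b bN => [|b IH] bN.
  by have := s2 (N - d1)%N; rewrite subKn; [apply; rewrite leq_subr|lia].
apply: creach_step (IH _) _; first by lia.
have -> : line b.+1 = occ_arrival (line b) 0 by case: b {IH bN}.
by apply: cstep_arrival; rewrite /idle_on /occ; case: b bN {IH} => /=; lia.
Qed.

(** With no server idle, arrivals only lengthen queues; the last task of a longest queue is added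
    last. *)
Lemma reach_busy q d1 : occ_valid q -> (occ q 1 + d1 = N)%N ->
  creach base (q, 0%N, d1).
Proof.
have [m] := ubnP (sumn q); elim: m q => // m IH q qm vq qN.
have [qd qp] := (occ_valid_nth q).1 vq.
have [q1|q1] := leqP (size q) 1.
  suff -> : q = line (occ q 1) by apply: reach_line; rewrite qN.
  case: q q1 qp {qm vq qN qd} => [//|a [|//]] _ qp; rewrite /occ /=.
  by have := qp 0%N; case: a {qp}.
case sq : (size q) q1 => [|[|j]] // _.
have ql : (nth 0 q j.+2 < nth 0 q j.+1)%N.
  by have := last_level vq; rewrite sq; exact.
pose q' := occ_departure q j.+2.
have vq' : occ_valid q' by exact: occ_departure_valid.
have q'E m' : nth 0%N q' m' = if m' == j.+1 then (nth 0%N q j.+1).-1 else nth 0%N q m'.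
  exact: nth_occ_departure.
have q'j : (nth 0 q' j.+1 < nth 0 q' j)%N.
  by rewrite !q'E eqxx ltn_eqF//; have := qd j; lia.
have q'1 : occ q' 1 = occ q 1 by rewrite /occ q'E.
have <- : occ_arrival q' j.+1 = q.
  apply: occ_valid_inj => //; first by rewrite occ_arrival_valid ?q'j ?orbT.
  move=> i; rewrite nth_incr_nth q'E eq_sym; case: eqP => [->|_] //.
  by rewrite add1n prednK// (leq_ltn_trans _ ql).
have vc : tabs_config N (q', 0%N, d1) by rewrite tabs_configE vq' q'1 addn0 qN leqnn.
apply: creach_step (cstep_arrival_busy vc _ q'j).
  by apply: IH => //; rewrite ?q'1//; move: qm; rewrite (sumn_departure vq ql).
by rewrite /idle_on q'1 addn0 qN subnn.
Qed.

(** Queues grow beyond one task only while no server is idle-on. So the servers meant to be idle-on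
    first hold a single task each, which departs once the queues are built. *)
Lemma reach_idle q d1 : tabs_config N (q, 0%N, d1) -> creach base (q, 0%N, d1).
Proof.
rewrite tabs_configE addn0 => /andP[vq qN].
have [m] := ubnP (N - (occ q 1 + d1))%N; elim: m q vq qN => // m IH q vq qN qm.
move: qN; rewrite leq_eqVlt => /predU1P[|qN]; first exact: reach_busy.
have [qd qp] := (occ_valid_nth q).1 vq.
pose q' := occ_arrival q 0.
have vq' : occ_valid q' by exact: occ_arrival_valid.
have q'E i : nth 0%N q' i = ((0%N == i) + nth 0 q i)%N by exact: nth_incr_nth.
have q'0 : (nth 0 q' 1 < nth 0 q' 0)%N by rewrite !q'E /= add0n add1n ltnS qd.
have q'1 : occ q' 1 = (occ q 1).+1 by rewrite /occ q'E.
have qE : occ_departure q' 1 = q.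
  apply: occ_valid_inj => //; first exact: occ_departure_valid.
  by move=> i; rewrite nth_occ_departure// !q'E eq_sym; case: eqP => [<-|].
rewrite -[q in (q, _, _)]qE; apply: creach_step (cstep_departure _ _ q'0).
by apply: IH => //; rewrite q'1; lia.
Qed.

Lemma reach_config c : tabs_config N c -> creach base c.
Proof.
case: c => [[q d0] d1]; elim: d0 => [|d0 IH] vc; first exact: reach_idle.
have := vc; rewrite tabs_configE => /andP[vq qN].
apply: creach_step (cstep_off _); last by rewrite /idle_on; lia.
by apply: IH; rewrite tabs_configE vq /=; lia.
Qed.

End Reachability.

(** * Choice of the constants *)

Section Assembly.
Context {R : realType}.
Implicit Types lambda mu nu : R.

(** [expR (y * n)] is at least [(y * n / 2) ^+ 2], which beats the linear factor. *)
Lemma mul_expR_small (C y e n : R) : 0 < C -> 0 < y -> 0 < e -> 0 < n ->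
  4 * C / (y ^+ 2 * e) <= n -> C * n * expR (- (y * n)) <= e.
Proof.
move=> C0 y0 e0 n0; rewrite ler_pdivrMr ?mulr_gt0 ?exprn_gt0// => h.
rewrite expRN ler_pdivrMr ?expR_gt0//.
have e1 : y * n / 2 <= expR (y * n / 2) by have := expR_ge1Dx (y * n / 2); lra.
have yn0 : 0 <= y * n / 2 by rewrite divr_ge0 ?mulr_ge0// ltW.
have e2 : (y * n / 2) ^+ 2 <= expR (y * n).
  have -> : y * n = y * n / 2 + y * n / 2 by lra.
  rewrite expRD expr2; have -> : (y * n / 2 + y * n / 2) / 2 = y * n / 2 by lra.
  exact: ler_pM.
apply: le_trans (ler_wpM2l (ltW e0) e2).
have := ler_wpM2r (ltW n0) h; rewrite -subr_ge0 => h'.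
by rewrite -subr_ge0; lra.
Qed.

Lemma natr_whole (k : nat) : whole (k%:R : R).
Proof. by case: k => [|k]; [left|right; rewrite ler1n]. Qed.

Lemma exists_phi lambda mu nu : 0 < lambda -> lambda < 1 -> 0 < mu -> 0 < nu ->
  exists N0 : nat, (0 < N0)%N /\ forall N : nat, (N0 <= N)%N ->
  exists (phi : R -> R -> R -> R -> R) (Phi eps : R),
  [/\ 0 < eps,
      forall b u d0 d1, 0 <= b -> 0 <= u -> 0 <= d0 -> 0 <= d1 -> 0 <= phi b u d0 d1,
      forall b u d0 d1, 0 <= b -> 0 <= u -> 0 <= d0 -> 0 <= d1 ->
        b + u + d0 + d1 = N%:R -> phi b u d0 d1 <= Phi &
      forall b u d0 d1 w, 1 <= b -> whole u -> whole d0 -> whole d1 ->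
        b + u + d0 + d1 = N%:R -> 0 <= w -> w <= b ->
        drift lambda mu nu N phi b u d0 d1 w <= - eps].
Proof.
move=> lam0 lam1 mu0 nu0.
have lam10 : 0 < 1 - lambda by lra.
pose a := (8 * mu)^-1; have a0 : 0 < a by rewrite invr_gt0 mulr_gt0.
have amu : a * mu <= 8^-1 by rewrite /a invfM mulfVK ?gt_eqF.
pose q := Num.min (Num.min (a * lambda) (a * nu * (1 - lambda) / 2)) ((1 - lambda) / 2).
have q0 : 0 < q by rewrite !lt_min !divr_gt0 ?mulr_gt0.
have qa : q <= a * lambda by rewrite !ge_min lexx.
have qnu : q <= a * nu * (1 - lambda) / 2 by rewrite !ge_min lexx orbT.
have q1 : q <= (1 - lambda) / 2 by rewrite !ge_min lexx orbT.
clearbody q.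
have q2 : 0 < 1 + q / 2 by rewrite addr_gt0// divr_gt0.
(* At [b = l1 * n] the load [lambda * n / b] is exactly [1 + q / 2]. *)
pose l1 := lambda / (1 + q / 2); have l10 : 0 < l1 by rewrite divr_gt0.
have l1E : lambda = l1 * (1 + q / 2) by rewrite /l1 mulfVK ?gt_eqF.
have l1lt : l1 < lambda by rewrite [ltRHS]l1E ltr_pMr// ltrDl divr_gt0.
clearbody l1.
pose l0 := (l1 + lambda) / 2.
have l0E : l0 - l1 = lambda - l0 by rewrite /l0; lra.
have l0lt : l0 < lambda by rewrite /l0; lra.
have l00 : 0 < l0 by rewrite /l0; lra.
clearbody l0.
have D0 : 0 < lambda - l0 by lra.
pose kappa := Num.min (1 - lambda)
  (Num.min ((lambda - l0) / (96 * nu)) ((lambda - l0) / 2)).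
have kap0 : 0 < kappa by rewrite !lt_min lam10 !divr_gt0 ?mulr_gt0.
have kap1 : kappa <= 1 - lambda by rewrite !ge_min lexx.
have kapn : 96 * nu * kappa <= lambda - l0.
  by rewrite mulrC -ler_pdivlMr ?mulr_gt0// !ge_min lexx orbT.
have kap2 : kappa <= (lambda - l0) / 2 by rewrite !ge_min lexx !orbT.
clearbody kappa.
pose sg := Num.min 96^-1 (nu * kappa / (8 * lambda)).
have sg0 : 0 < sg.
  rewrite lt_min; apply/andP; split; first by rewrite invr_gt0.
  by rewrite divr_gt0 ?mulr_gt0.
have sg1 : sg <= 96^-1 by rewrite ge_min lexx.
have sgk : 8 * sg * lambda <= nu * kappa.
  rewrite [8 * sg]mulrC -mulrA -ler_pdivlMr ?mulr_gt0//.
  by rewrite ge_min lexx orbT.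
clearbody sg.
pose c1 := (lambda - l0) * sg / 4; have c10 : 0 < c1 by rewrite divr_gt0// mulr_gt0.
pose eta := Num.min (c1 / mu) ((lambda - l0) / 8).
have eta0 : 0 < eta by rewrite lt_min; apply/andP; split; apply: divr_gt0.
have etac : mu * eta <= c1 by rewrite mulrC -ler_pdivlMr// ge_min lexx.
have eta8 : eta <= (lambda - l0) / 8 by rewrite ge_min lexx orbT.
clearbody eta.
pose C := total_rate lambda mu nu.
have C0 : 0 < C by rewrite /C /total_rate !addr_gt0.
pose c := c1 / (4 * C); have c0 : 0 < c by rewrite divr_gt0// mulr_gt0.
pose y := c * (lambda - l0) / 2; have y0 : 0 < y by rewrite divr_gt0// mulr_gt0.
have e0 : 0 < q / 4 by rewrite divr_gt0.
(* One summand for each requirement on [N], in the order [kn], [hn], [Nbig], [Nsmall]. *)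
pose X := kappa^-1 + 2 / (eta * c1) + 8 * lambda / (c ^+ 2 * c1 * (lambda - l0)) +
  4 * C / (y ^+ 2 * (q / 4)).
have x1 : 0 <= kappa^-1 by rewrite invr_ge0 ltW.
have x2 : 0 <= 2 / (eta * c1) by apply/ltW/divr_gt0 => //; exact: mulr_gt0.
have x3 : 0 <= 8 * lambda / (c ^+ 2 * c1 * (lambda - l0)).
  by apply/ltW/divr_gt0; do ?apply: mulr_gt0 => //; exact: exprn_gt0.
have x4 : 0 <= 4 * C / (y ^+ 2 * (q / 4)).
  by apply/ltW/divr_gt0; do ?apply: mulr_gt0 => //; exact: exprn_gt0.
exists (Num.bound X).+1; split=> // N NX.
have n1 : 1 <= N%:R :> R by rewrite ler1n; apply: leq_trans NX.
have n0 : 0 < N%:R :> R by apply: lt_le_trans n1.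
have nX : X <= N%:R.
  by apply: (le_trans (ltW (unstable.ltr_bound X))); rewrite ler_nat ltnW.
have kn : 1 <= kappa * N%:R.
  by rewrite mulrC -ler_pdivrMr// div1r; move: nX; rewrite /X; lra.
have hn : 2 / (eta * N%:R) <= c1.
  rewrite ler_pdivrMr ?mulr_gt0// mulrCA mulrA mulrC -ler_pdivrMr ?mulr_gt0//.
  by move: nX; rewrite /X; lra.
have Nbig : lambda <= c * c1 / 2 * expR (c * (lambda - l0) / 4 * N%:R).
  have := expR_ge1Dx (c * (lambda - l0) / 4 * N%:R) => h.
  apply: (@le_trans _ _ (c * c1 / 2 * (c * (lambda - l0) / 4 * N%:R))).
    have -> : c * c1 / 2 * (c * (lambda - l0) / 4 * N%:R) =
      N%:R * (c ^+ 2 * c1 * (lambda - l0)) / 8 by field.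
    have : 8 * lambda <= N%:R * (c ^+ 2 * c1 * (lambda - l0)).
      rewrite -ler_pdivrMr; last by do ?apply: mulr_gt0 => //; exact: exprn_gt0.
      by move: nX; rewrite /X; lra.
    lra.
  apply: ler_wpM2l; last by lra.
  by apply/ltW/divr_gt0 => //; exact: mulr_gt0.
have Nsmall : C * N%:R * expR (- (c * (lambda - l0) / 2 * N%:R)) <= q / 4.
  by apply: mul_expR_small => //; move: nX; rewrite /X -/y; lra.
exists (phi_fun a N%:R (expR (c * ((l1 + l0) / 2 * N%:R)))
    (zeta (1 - sg) (24 * sg) (eta * N%:R) (kappa * N%:R) c)).
exists (2 * a + expR (c * ((l1 + l0) / 2 * N%:R))), (q / 4).
have s0 : 0 <= 1 - sg by lra.
have t0 : 0 <= 24 * sg by lra.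
have h0 : 0 < eta * N%:R by rewrite mulr_gt0.
have k0 : 0 < kappa * N%:R by rewrite mulr_gt0.
split=> //.
- move=> b u d0 d1 b0 u0 d00 d10; apply: addr_ge0; last by rewrite mulr_ge0 ?expR_ge0.
  by rewrite /setup_cost divr_ge0 ?mulr_ge0 ?addr_ge0 ?mulr_ge0// ltW.
- move=> b u d0 d1 b0 u0 d00 d10 sumN; apply: lerD.
    rewrite /setup_cost ler_pdivrMr// [2 * a]mulrC -mulrA ler_wpM2l ?(ltW a0)//; lra.
  rewrite ler_piMr ?expR_ge0// -[leRHS]expR0 ler_expR oppr_le0 mulr_ge0 ?(ltW c0)//.
  rewrite /ell; apply: addr_ge0; last by rewrite mulr_ge0 ?rho_ge0.
  by apply: addr_ge0 => //; rewrite mulr_ge0 ?rho_ge0.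
move=> b u d0 d1 w b1 cu cd0 cd1 sumN w0 wb.
by apply: (@phi_drift_le _ lambda mu nu a q l1 l0 sg eta kappa c).
Qed.

End Assembly.

Lemma wsum_ge0 (R : realType) (f : nat -> R) q : (forall m, 0 <= f m) -> 0 <= wsum f q.
Proof. by move=> f0; apply: sumr_ge0 => m _; rewrite mulr_ge0. Qed.

Theorem theorem2p1 (R : realType) (lambda mu nu : R)
  (mu_gt0 : 0 < mu) (nu_gt0 : 0 < nu)
  (lambda_gt0 : 0 < lambda) (lambda_lt1 : lambda < 1) :
  exists N0 : nat, forall N : nat, (N0 <= N)%N ->
    positive_recurrent (@tabs_rate R lambda mu nu N).
Proof.
have [N0 [N00 ph]] := exists_phi lambda_gt0 lambda_lt1 mu_gt0 nu_gt0.
exists N0 => N N0N; have N_gt0 : (0 < N)%N by exact: leq_trans N0N.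
have [phi [Phi [eps [eps0 phi_ge0 phi_le phi_drift]]]] := ph N N0N.
have sp_ge0 c : 0 <= state_phi N phi c by case: c => [[q d0] d1]; exact: phi_ge0.
have sp_le c : tabs_config N c -> state_phi N phi c <= Phi.
  case: c => [[q d0] d1]; rewrite tabs_configE => /andP[vq qN].
  apply: phi_le => //; rewrite -!natrD; congr (_%:R); rewrite /idle_on; lia.
have base_valid : tabs_config N (base N).
  by rewrite tabs_configE /occ /=; lia.
pose base' : tabs_state N := Sub (base N) base_valid.
pose K := N%:R * (lambda * (2^-1 + Phi) + 2^-1).
(* [drain] bounds the number of jumps to [base] by [h], and [h] is at most [3 * M + 2 * N], so a
   drift of [- eps * M] is one of [- eps / 3 * h] up to a constant. *)
pose h (y : tabs_state N) := size_of N (val y).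
have gen_le (y : tabs_state N) :
    \sum_(z <- tabs_succ lambda mu nu y) tabs_rate lambda mu nu y z *
      (lyap N phi (val z) - lyap N phi (val y)) <=
    K + eps / 3 * (2 * N%:R) - eps / 3 * (h y)%:R.
  rewrite (sum_tabs_rate lambda_gt0 mu_gt0 nu_gt0 y
    (fun c => lyap N phi c - lyap N phi (val y))).
  rewrite /h; case: y => [[[q d0] d1] vc] /=.
  have := vc; rewrite tabs_configE => /andP[vq qN].
  apply: (le_trans (lyap_drift lambda_gt0 mu_gt0 nu_gt0 sp_ge0 sp_le vc)).
  set M := wsum _ q; have M0 : 0 <= M by exact: wsum_ge0.
  have MD : M * drift lambda mu nu N phi (occ q 1)%:R (idle_on N (q, d0, d1))%:R
      d0%:R d1%:R (level q 0) <= - (eps * M).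
    have [b0|b_gt0] := posnP (occ q 1).
      by rewrite /M wsum0// mul0r mulr0 oppr0.
    rewrite -mulNr [leRHS]mulrC ler_wpM2l//; apply: phi_drift.
    - by rewrite ler1n.
    - exact: natr_whole.
    - exact: natr_whole.
    - exact: natr_whole.
    - by rewrite -!natrD; congr (_%:R); rewrite /idle_on; lia.
    - by [].
    - by rewrite /level ler_nat leq_subr.
  have hM : (size_of N (q, d0, d1))%:R <= 3 * M + 2 * N%:R.
    rewrite /M wsum1E -!natrM -natrD ler_nat size_ofE.
    by move: qN; lia.
  have := ler_wpM2l (ltW (_ : 0 < eps / 3)) hM; rewrite divr_gt0// => /(_ isT).
  rewrite -/K; lra.
apply: (@irreducible_foster _ _ _ (tabs_succ lambda mu nu (N := N)) _ _ _
  (rate_min lambda mu nu) ((lambda + 1 + mu + nu) * N%:R) _ _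
  (fun y => lyap N phi (val y)) h (eps / 3) (K + eps / 3 * (2 * N%:R))).
- exact: tabs_rate_ge0.
- by move=> y; exact: undup_uniq.
- by move=> y z; exact: tabs_rate_succ.
- exact: rate_min_gt0.
- exact: sum_tabs_rate_le.
- move=> y; apply: addr_ge0; first by apply: wsum_ge0 => m; exact: addr_ge0.
  by apply: mulr_ge0 => //; exact: wsum_ge0.
- by rewrite divr_gt0.
- exact: gen_le.
- move=> x; have [l p] := reach_config lambda_gt0 mu_gt0 nu_gt0 N_gt0 (valP x).
  exists l => y; have [k [kle p']] := drain lambda_gt0 mu_gt0 nu_gt0 N_gt0 (valP y).
  exists (k + l)%N; rewrite leq_add2r; split=> //.
  apply: (cpath_reach lambda_gt0 mu_gt0 nu_gt0); exact: cpath_cat p' p.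
move=> x; have [->|xb] := eqVneq x base'; last by exists base'; rewrite eq_sym.
have v : tabs_config N ([::], 0%N, N) by rewrite tabs_configE /occ /=; lia.
exists (Sub ([::], 0%N, N) v); rewrite -val_eqE /= /base.
by apply/eqP => -[e _]; move: N_gt0; rewrite -e.
Qed.
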